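(* Fix $\theta\in[0,2\pi)$, and define $$\beta_1=\tfrac1{\sqrt2}\cos\theta-\tfrac1{\sqrt6}\sin\theta,\quad \beta_2=-\tfrac1{\sqrt2}\cos\theta-\tfrac1{\sqrt6}\sin\theta,\quad \beta_3=\tfrac{2}{\sqrt6}\sin\theta,$$ $$\gamma_1=-\tfrac1{\sqrt6}\cos\theta-\tfrac1{\sqrt2}\sin\theta,\quad \gamma_2=-\tfrac1{\sqrt6}\cos\theta+\tfrac1{\sqrt2}\sin\theta,\quad \gamma_3=\tfrac{2}{\sqrt6}\cos\theta.$$ Let $y_1,y_2,y_3:\mathbb{R}\to\mathbb{C}$, $v:\mathbb{R}\to\mathbb{R}$ be functions of $s$ and $z_1,z_2,z_3:\mathbb{R}\to\mathbb{C}$, $w:\mathbb{R}\to\mathbb{R}$ be functions of $t$ satisfying, for all $s,t\in\mathbb{R}$, $$\frac{dy_1}{ds}=\beta_1\overline{y_2y_3},\quad \frac{dy_2}{ds}=\beta_2\overline{y_3y_1},\quad \frac{dy_3}{ds}=\beta_3\overline{y_1y_2},\qquad |y_j|^2=\beta_jv+1\ (j=1,2,3),$$ $$\frac{dz_1}{dt}=\gamma_1\overline{z_2z_3},\quad \frac{dz_2}{dt}=\gamma_2\overline{z_3z_1},\quad \frac{dz_3}{dt}=\gamma_3\overline{z_1z_2},\qquad |z_j|^2=\gamma_jw+1\ (j=1,2,3).$$ Define $\Phi:\mathbb{R}^3\to\mathbb{C}^3$ by $\Phi(r,s,t)=\frac1{\sqrt3}\bigl(ry_1(s)z_1(t),ry_2(s)z_2(t),ry_3(s)z_3(t)\bigr)$.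 Then $|\Phi(r,s,t)|^2=r^2$, and $\frac{\partial\Phi}{\partial r},\frac{\partial\Phi}{\partial s},\frac{\partial\Phi}{\partial t}$ are orthogonal, with $\bigl|\frac{\partial\Phi}{\partial r}\bigr|^2=1$ and $$\Bigl|\frac{\partial\Phi}{\partial s}\Bigr|^2=\Bigl|\frac{\partial\Phi}{\partial t}\Bigr|^2=2r^2\bigl(a+bv(s)+cw(t)\bigr),$$ where $$a=\tfrac16(\beta_1^2+\beta_2^2+\beta_3^2)=\tfrac16(\gamma_1^2+\gamma_2^2+\gamma_3^2)=\tfrac16,$$ $$b=-\tfrac16(\beta_1^3+\beta_2^3+\beta_3^3)=\tfrac16(\beta_1\gamma_1^2+\beta_2\gamma_2^2+\beta_3\gamma_3^2)=-\tfrac12\beta_1\beta_2\beta_3,$$ $$c=\tfrac16(\beta_1^2\gamma_1+\beta_2^2\gamma_2+\beta_3^2\gamma_3)=-\tfrac16(\gamma_1^3+\gamma_2^3+\gamma_3^3)=-\tfrac12\gamma_1\gamma_2\gamma_3.$$ The maps $\phi:\mathbb{R}^2\to\mathcal{S}^5$ and $\psi:\mathbb{R}^2\to\mathbb{CP}^2$ defined by $\phi(s,t)=\Phi(1,s,t)$ and $\psi(s,t)=[\Phi(1,s,t)]$ are both conformal harmonic maps.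
   Context: $\mathbb{C}^3$ carries its standard Euclidean metric $g(x,y)=\operatorname{Re}(x_1\bar y_1+x_2\bar y_2+x_3\bar y_3)$, and orthogonality is with respect to $g$. $\mathcal{S}^5$ is the unit sphere in $\mathbb{C}^3$ with the induced metric, and $\mathbb{CP}^2$ has the Fubini–Study metric for which the Hopf projection $\mathcal{S}^5\to\mathbb{CP}^2$ is a Riemannian submersion. $\mathbb{R}^2$ has coordinates $(s,t)$ and the flat metric $ds^2+dt^2$. A map from a surface is conformal if the pullback of the target metric is pointwise a nonnegative multiple of the domain metric (the multiple being allowed to vanish at points where the derivative vanishes). A map is harmonic if it is a critical point of the energy functional $\int|d\phi|^2\,dV$ (with respect to compactly supported variations). *)

(* Defs.v *)
From Stdlib Require Import Reals.
From Coquelicot Require Import Coquelicot.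
Open Scope R_scope.

(* The norms of [R2] and [C3] are the Euclidean ones.  The structure over [R] has to be given explicitly for [C], whose default
   structure in Coquelicot is the one over [C]. *)
Definition R2 : NormedModule R_AbsRing :=
  prod_NormedModule R_AbsRing R_NormedModule R_NormedModule.

Definition C3 : NormedModule R_AbsRing :=
  prod_NormedModule R_AbsRing
    (prod_NormedModule R_AbsRing C_R_NormedModule C_R_NormedModule)
    C_R_NormedModule.

Definition mkR2 (s t : R) : R2 := (s, t).
Definition mkC3 (x1 x2 x3 : C) : C3 := (x1, x2, x3).

Definition co1 (x : C3) : C := fst (fst x).
Definition co2 (x : C3) : C := snd (fst x).
Definition co3 (x : C3) : C := snd x.

Definition dot2 (X Y : R2) : R := fst X * fst Y + snd X * snd Y.

Definition g (x y : C3) : R :=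
  Re (co1 x * Cconj (co1 y) + co2 x * Cconj (co2 y) + co3 x * Cconj (co3 y))%C.

Definition cscal (c : C) (x : C3) : C3 :=
  mkC3 (c * co1 x)%C (c * co2 x)%C (c * co3 x)%C.

Definition DeriveC (f : R -> C) (x : R) : C :=
  (Derive (fun h => Re (f h)) x, Derive (fun h => Im (f h)) x).

(* Like [Derive], this is meaningful only where [f] is differentiable, and is
   only used for smooth [f]. *)
Definition dirD {E : NormedModule R_AbsRing} (f : E -> C3) (p X : E) : C3 :=
  let l := fun h : R => f (plus p (scal h X)) in
  mkC3 (DeriveC (fun h => co1 (l h)) 0)
       (DeriveC (fun h => co2 (l h)) 0)
       (DeriveC (fun h => co3 (l h)) 0).

(* [f] is of class C^k on the open set [U]: the iterated directional
   derivatives of order at most [k] exist and are continuous on [U].  This is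
   the usual notion when [E] is finite-dimensional; below, [E] is R^2 or R^3. *)
Fixpoint class_C (k : nat) {E : NormedModule R_AbsRing} (U : E -> Prop)
    (f : E -> C3) : Prop :=
  (forall p, U p -> continuous f p) /\
  match k with
  | O => True
  | S k' =>
      forall X : E, exists df : E -> C3,
        (forall p, U p ->
           is_derive (K := R_AbsRing) (V := C3)
             (fun h : R => f (plus p (scal h X))) 0 (df p)) /\
        class_C k' U df
  end.

Definition smooth {E : NormedModule R_AbsRing} (U : E -> Prop) (f : E -> C3)
    : Prop :=
  forall k, class_C k U f.

(* What is needed of a Riemannian manifold [(N, h)] in order to speak of
   conformal and harmonic maps into it: which maps from an open set of R^n to
   [N] are smooth, and the pullback [u^* h] at a point, a bilinear form on the
   domain.  [pt] may be larger than [N]; a smooth map on [U] takes values in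
   [N] on [U]. *)
Record target := Target {
  pt : Type;
  smooth_map : forall E : NormedModule R_AbsRing,
    (E -> Prop) -> (E -> pt) -> Prop;
  pullback : forall E : NormedModule R_AbsRing,
    (E -> pt) -> E -> E -> E -> R
}.
Arguments smooth_map N {E} U u : rename.
Arguments pullback N {E} u p X Y : rename.

Definition on_sphere (x : C3) : Prop := g x x = 1.

Definition S5 : target := {|
  pt := C3;
  smooth_map := fun E U f => smooth U f /\ forall p, U p -> on_sphere (f p);
  pullback := fun E f p X Y => g (dirD f p X) (dirD f p Y)
|}.

(* A point of CP^2 is a complex line through the origin of C^3. *)
Definition hopf (x : C3) : C3 -> Prop := fun y => exists c : C, y = cscal c x.

(* [f] is a smooth lift of [u] through the Hopf projection near [p].  As the
   Hopf projection is a surjective submersion, a map into CP^2 is smooth if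
   and only if it has such lifts near every point. *)
Definition local_lift {E : NormedModule R_AbsRing} (u : E -> (C3 -> Prop))
    (p : E) (f : E -> C3) : Prop :=
  exists W : E -> Prop,
    open W /\ W p /\ smooth W f /\
    forall q, W q -> on_sphere (f q) /\ u q = hopf (f q).

(* For [x] on the sphere, the fibre of the Hopf projection through [x] has
   tangent line R (i x) at [x], and [i x] is a unit vector; [hor x xi] is the
   component of [xi] orthogonal to the fibre. *)
Definition hor (x xi : C3) : C3 :=
  minus xi (scal (g xi (cscal Ci x)) (cscal Ci x)).

(* The Hopf projection being a Riemannian submersion, the Fubini-Study inner
   product of [du X] and [du Y] is that of the horizontal parts of [df X] and
   [df Y], for any lift [f].  [iota] denotes the unique real with the given
   property. *)
Definition CP2 : target := {|
  pt := C3 -> Prop;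
  smooth_map := fun E U u => forall p, U p -> exists f, local_lift u p f;
  pullback := fun E u p X Y =>
    iota (fun c : R => exists f, local_lift u p f /\
      c = g (hor (f p) (dirD f p X)) (hor (f p) (dirD f p Y)))
|}.

Definition conformal (N : target) (u : R2 -> pt N) : Prop :=
  smooth_map N (fun _ => True) u /\
  forall p : R2, exists lam : R, 0 <= lam /\
    forall X Y : R2, pullback N u p X Y = lam * dot2 X Y.

Definition energy_density (N : target) (u : R2 -> pt N) (p : R2) : R :=
  pullback N u p (mkR2 1 0) (mkR2 1 0) + pullback N u p (mkR2 0 1) (mkR2 0 1).

Definition energy (N : target) (rho : R) (u : R2 -> pt N) : R :=
  RInt (fun s => RInt (fun t => energy_density N u (mkR2 s t)) (- rho) rho)
    (- rho) rho.

(* The total energy over R^2 may be infinite, so the energy is taken over a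
   square outside which the variation is constant. *)
Definition harmonic (N : target) (u : R2 -> pt N) : Prop :=
  smooth_map N (fun _ => True) u /\
  forall (delta rho : R) (F : R -> R2 -> pt N),
    0 < delta -> 0 < rho ->
    smooth_map N (E := prod_NormedModule R_AbsRing R_NormedModule R2)
      (fun x => Rabs (fst x) < delta) (fun x => F (fst x) (snd x)) ->
    (forall p, F 0 p = u p) ->
    (forall eps s t, Rabs eps < delta -> rho < Rabs s \/ rho < Rabs t ->
       F eps (mkR2 s t) = u (mkR2 s t)) ->
    is_derive (fun eps => energy N rho (F eps)) 0 0.

Definition beta1 (theta : R) : R :=
  1 / sqrt 2 * cos theta - 1 / sqrt 6 * sin theta.
Definition beta2 (theta : R) : R :=
  - (1 / sqrt 2) * cos theta - 1 / sqrt 6 * sin theta.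
Definition beta3 (theta : R) : R := 2 / sqrt 6 * sin theta.

Definition gamma1 (theta : R) : R :=
  - (1 / sqrt 6) * cos theta - 1 / sqrt 2 * sin theta.
Definition gamma2 (theta : R) : R :=
  - (1 / sqrt 6) * cos theta + 1 / sqrt 2 * sin theta.
Definition gamma3 (theta : R) : R := 2 / sqrt 6 * cos theta.

Definition is_deriveC (f : R -> C) (x : R) (l : C) : Prop :=
  is_derive (K := R_AbsRing) (V := C_R_NormedModule) f x l.

Definition is_derive3 (f : R -> C3) (x : R) (l : C3) : Prop :=
  is_derive (K := R_AbsRing) (V := C3) f x l.

Definition Phi (y1 y2 y3 z1 z2 z3 : R -> C) (r s t : R) : C3 :=
  cscal (RtoC (1 / sqrt 3))
    (mkC3 (RtoC r * y1 s * z1 t)%C (RtoC r * y2 s * z2 t)%C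
       (RtoC r * y3 s * z3 t)%C).

(* Main.v *)
Require Import Defs.
From Stdlib Require Import Reals Lra ClassicalEpsilon List.
From Stdlib Require Nsatz.
From Coquelicot Require Import Coquelicot.
Import ListNotations.
Open Scope R_scope.

(** Write Phi(r,s,t) = (r / sqrt 3) Y(s) * Z(t), where * is the componentwise
    product in C^3 and Y = (y_j), Z = (z_j).  The three vectors (beta_j),
    (gamma_j) and (1,1,1)/sqrt 3 are orthonormal in R^3, hence so are the columns
    of the matrix they form; the resulting relations sum beta_j = sum gamma_j =
    sum beta_j gamma_j = 0 and beta_j^2 + gamma_j^2 = 2/3, with the values of
    |y_j|^2 and |z_j|^2, give every metric identity.  They also show that
    phi = Phi(1,.,.) is Legendrian: the Hermitian products of phi_s and phi_t with
    phi vanish.  Since y_j'' = (2 beta_1 beta_2 beta_3 v - beta_j^2) y_j, and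
    likewise for z_j, the flat Laplacian of phi is a real multiple of phi.

    Conformality in S^5 is then the equality of norms of phi_s and phi_t with their
    orthogonality; for CP^2 one adds that the derivatives of phi, being
    Legendrian, are horizontal.

    Harmonicity rests on the first variation formula of the Dirichlet energy of a
    real function ([first_variation_dirichlet]).  Given a variation G of G_0 which
    is constant outside a square, put H = G - G_0; then
      |dG|^2 = |dG_0|^2 + (|dH|^2 - 2 (Delta G_0) H) + 2 div (H grad G_0).
    The divergence integrates to 0, and the middle term is differentiated under
    the integral sign, with derivative - 2 (Delta G_0) dG/deps at eps = 0, as H
    vanishes there.  No commutation of partial derivatives is needed.

    A map into S^5 has six real coordinates, and their energy densities add up to
    that of the map.  The variation field at eps = 0 is orthogonal to phi, whence
    the claim as Delta phi is proportional to phi ([harmonic_S5]).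

    The complex line through a unit vector x is encoded by its orthogonal projector
    x x^H, where x^H is the conjugate transpose.  It depends only on the line, so
    that a map into CP^2 with smooth local lifts becomes one smooth map into
    matrices.  The Fubini-Study product is half the Hilbert-Schmidt product of the
    derivatives of the projectors ([g_hor_proj]).  By the first variation formula
    it remains to see that
    Delta (phi phi^H) = 2 mu phi phi^H + 2 (phi_s phi_s^H + phi_t phi_t^H) is
    orthogonal to every tangent vector X phi^H + phi X^H with Re <phi, X> = 0,
    which is where the Legendrian condition is used a second time
    ([legendrian_harmonic_CP2]). *)

(** * Continuity of pairs and of real-valued operations *)

Lemma open_all {T : UniformSpace} : open (fun _ : T => True).
Proof. intros x _. now apply filter_forall. Qed.

Lemma continuous_pair {T U V : UniformSpace} (f : T -> U) (h : T -> V) (x : T) :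
  continuous f x -> continuous h x -> continuous (fun y => (f y, h y)) x.
Proof.
intros Hf Hh. apply filterlim_locally. intros eps.
generalize (filter_and _ _ (proj1 (filterlim_locally f (f x)) Hf eps)
  (proj1 (filterlim_locally h (h x)) Hh eps)).
apply filter_imp. intros y [H1 H2]. now split.
Qed.

Lemma cont_plus {T : UniformSpace} (f h : T -> R) (x : T) :
  continuous f x -> continuous h x -> continuous (fun y => f y + h y) x.
Proof. apply (continuous_plus (V := R_NormedModule)). Qed.

Lemma cont_mult {T : UniformSpace} (f h : T -> R) (x : T) :
  continuous f x -> continuous h x -> continuous (fun y => f y * h y) x.
Proof. apply (continuous_mult (K := R_AbsRing)). Qed.

Lemma cont_opp {T : UniformSpace} (f : T -> R) (x : T) :
  continuous f x -> continuous (fun y => - f y) x.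
Proof. apply (continuous_opp (V := R_NormedModule)). Qed.

Lemma cont_minus {T : UniformSpace} (f h : T -> R) (x : T) :
  continuous f x -> continuous h x -> continuous (fun y => f y - h y) x.
Proof. intros. apply cont_plus; [ | apply cont_opp]; assumption. Qed.

(** * Integrals depending on a parameter *)

(** Continuity at every point of the segment {x0} x [a,b] is uniform along the
    segment. *)
Lemma tube_lemma {T : UniformSpace} (f : T -> R -> R) (a b : R) (x0 : T) :
  (forall t, a <= t <= b ->
     continuous (fun p : T * R => f (fst p) (snd p)) (x0, t)) ->
  forall eps : posreal,
    locally x0 (fun x => forall t, a <= t <= b ->
      Rabs (f x t - f x0 t) < eps).
Proof.
intros Hc eps.
assert (Hd : forall t, exists d : posreal, a <= t <= b ->
   forall x u, ball x0 d x -> Rabs (u - t) < d ->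
     Rabs (f x u - f x0 t) < eps / 2).
{ intros t.
  destruct (Rle_dec a t) as [H1 | H1]; [ | exists eps; intros; lra].
  destruct (Rle_dec t b) as [H2 | H2]; [ | exists eps; intros; lra].
  specialize (Hc t (conj H1 H2)).
  apply filterlim_locally with (eps := pos_div_2 eps) in Hc.
  destruct Hc as [d Hd]. exists d. intros _ x u Hx Hu.
  apply (Hd (x, u)). split; [exact Hx | exact Hu]. }
set (delta := fun t => proj1_sig (constructive_indefinite_description _ (Hd t))).
assert (Hdelta := fun t =>
  proj2_sig (constructive_indefinite_description _ (Hd t))).
change (forall t, a <= t <= b -> forall x u, ball x0 (delta t) x ->
  Rabs (u - t) < delta t -> Rabs (f x u - f x0 t) < eps / 2) in Hdelta.
(* A Lebesgue number of the cover of [a,b] by the intervals of radius [delta]. *)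
destruct (compactness_value_1d a b delta) as [d Hdd].
exists d. intros x Hx t Ht.
apply Rnot_le_lt. intros Hn.
apply (Hdd t Ht). intros [u [Hu [Htu Hdu]]].
apply (Rle_not_lt _ _ Hn).
assert (E1 := Hdelta u Hu x t (ball_le _ _ _ Hdu _ Hx) Htu).
assert (E2 := Hdelta u Hu x0 t (ball_center _ _) Htu).
replace (f x t - f x0 t) with ((f x t - f x0 u) - (f x0 t - f x0 u)) by ring.
apply Rle_lt_trans with (1 := Rabs_triang _ _). rewrite Rabs_Ropp. lra.
Qed.

(** Continuity of a parametric integral, the parameter ranging over any uniform
    space. *)
Lemma continuous_RInt_param {T : UniformSpace} (f : T -> R -> R) (a b : R)
    (x0 : T) :
  a <= b ->
  (forall t, a <= t <= b ->
     continuous (fun p : T * R => f (fst p) (snd p)) (x0, t)) ->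
  locally x0 (fun x => ex_RInt (f x) a b) ->
  continuous (fun x => RInt (f x) a b) x0.
Proof.
intros Hab Hc Hex.
apply filterlim_locally. intros eps.
assert (He : 0 < eps / (b - a + 1)).
{ apply Rdiv_lt_0_compat; [apply cond_pos | lra]. }
generalize (filter_and _ _ Hex (tube_lemma f a b x0 Hc (mkposreal _ He))).
apply filter_imp. intros x [Hx Ht]. simpl in Ht.
assert (H0 := locally_singleton _ _ Hex).
change (Rabs (minus (RInt (f x) a b) (RInt (f x0) a b)) < eps).
rewrite <- (RInt_minus _ _ _ _ Hx H0).
apply Rle_lt_trans with ((b - a) * (eps / (b - a + 1))).
- apply abs_RInt_le_const; [exact Hab | now apply @ex_RInt_minus | ].
  intros t Htt. left. apply (Ht t Htt).
- assert (Hp := cond_pos eps).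
  apply Rmult_lt_reg_r with (b - a + 1); [lra | ].
  replace ((b - a) * (eps / (b - a + 1)) * (b - a + 1)) with ((b - a) * eps)
    by (field; lra).
  nra.
Qed.

(** Differentiation under the integral sign when the partial derivative is jointly
    continuous. *)
Lemma is_derive_RInt_cont (f f' : R -> R -> R) (a b x0 : R) :
  a <= b ->
  locally x0 (fun x => forall t, is_derive (fun u => f u t) x (f' x t)) ->
  (forall t, continuous (fun p : R * R => f' (fst p) (snd p)) (x0, t)) ->
  locally x0 (fun x => forall t, continuous (f x) t) ->
  is_derive (fun x => RInt (f x) a b) x0 (RInt (f' x0) a b).
Proof.
intros Hab Hd Hc Hf.
replace (RInt (f' x0) a b) with
  (RInt (fun t => Derive (fun u => f u t) x0) a b).
- apply is_derive_RInt_param.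
  + revert Hd. apply filter_imp. intros x Hx t _. eexists. apply Hx.
  + intros t _. apply continuity_2d_pt_filterlim.
    assert (E : Derive (fun z => f z t) x0 = f' x0 t).
    { apply is_derive_unique, (locally_singleton _ _ Hd). }
    rewrite E.
    apply (filterlim_ext_loc (fun p : R * R => f' (fst p) (snd p))).
    * destruct Hd as [d Hd]. exists d. intros p [Hp _].
      symmetry. apply is_derive_unique, Hd, Hp.
    * apply Hc.
  + revert Hf. apply filter_imp. intros x Hx.
    apply (ex_RInt_continuous (V := R_CompleteNormedModule)). intros z _. apply Hx.
- apply RInt_ext. intros t _. apply is_derive_unique.
  apply (locally_singleton _ _ Hd).
Qed.

(** R x R^2, with points (eps, (s, t)). *)
Definition R3 : NormedModule R_AbsRing :=
  prod_NormedModule R_AbsRing R_NormedModule R2.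

(** The iterated integral over the square [-rho, rho]^2; [energy] is an instance. *)
Definition dint (rho : R) (f : R2 -> R) : R :=
  RInt (fun s => RInt (fun t => f (mkR2 s t)) (- rho) rho) (- rho) rho.

Lemma continuous_slice2 {T U V : UniformSpace} (f : T * U -> V) (x : T) (y : U) :
  continuous f (x, y) -> continuous (fun u => f (x, u)) y.
Proof.
intros H. apply (continuous_comp (fun u => (x, u)) f); [ | exact H].
apply (continuous_pair (fun _ => x) (fun u => u)).
- apply continuous_const.
- apply continuous_id.
Qed.

Lemma continuous_RInt_R2 (a b : R) (f : R2 -> R) :
  a <= b -> (forall p, continuous f p) ->
  forall s, continuous (fun s => RInt (fun t => f (mkR2 s t)) a b) s.
Proof.
intros Hab Hf s.
apply (continuous_RInt_param (fun s t => f (mkR2 s t))).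
- exact Hab.
- intros t _. apply (continuous_ext f).
  + intros [u v]. reflexivity.
  + apply Hf.
- apply filter_forall. intros x.
  apply (ex_RInt_continuous (V := R_CompleteNormedModule)). intros t _.
  apply (continuous_slice2 f). apply Hf.
Qed.

Lemma ex_RInt_R2 (a b : R) (f : R2 -> R) (s : R) :
  (forall p, continuous f p) -> ex_RInt (fun t => f (mkR2 s t)) a b.
Proof.
intros Hf. apply (ex_RInt_continuous (V := R_CompleteNormedModule)). intros t _.
apply (continuous_slice2 f). apply Hf.
Qed.

Lemma dint_ext (rho : R) (f h : R2 -> R) :
  (forall p, f p = h p) -> dint rho f = dint rho h.
Proof.
intros H. apply RInt_ext. intros s _. apply RInt_ext. intros t _. apply H.
Qed.

Lemma dint_plus (rho : R) (f h : R2 -> R) :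
  0 < rho -> (forall p, continuous f p) -> (forall p, continuous h p) ->
  dint rho (fun p => f p + h p) = dint rho f + dint rho h.
Proof.
intros Hr Hf Hh. unfold dint.
rewrite <- (RInt_plus (V := R_CompleteNormedModule)).
- apply RInt_ext. intros s _.
  apply (RInt_plus (V := R_CompleteNormedModule)); now apply ex_RInt_R2.
- apply (ex_RInt_continuous (V := R_CompleteNormedModule)). intros s _.
  apply continuous_RInt_R2; [lra | auto].
- apply (ex_RInt_continuous (V := R_CompleteNormedModule)). intros s _.
  apply continuous_RInt_R2; [lra | auto].
Qed.

Lemma dint_scal (rho k : R) (f : R2 -> R) :
  0 < rho -> (forall p, continuous f p) ->
  dint rho (fun p => k * f p) = k * dint rho f.
Proof.
intros Hr Hf. unfold dint.
rewrite <- (RInt_scal (V := R_CompleteNormedModule)).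
- apply RInt_ext. intros s _.
  apply (RInt_scal (V := R_CompleteNormedModule)); now apply ex_RInt_R2.
- apply (ex_RInt_continuous (V := R_CompleteNormedModule)). intros s _.
  apply continuous_RInt_R2; [lra | auto].
Qed.

Lemma dint_zero (rho : R) : dint rho (fun _ => 0) = 0.
Proof.
unfold dint. rewrite (RInt_ext _ (fun _ => 0)).
- rewrite RInt_const. unfold scal. simpl. unfold mult. simpl. ring.
- intros s _. rewrite RInt_const. unfold scal. simpl. unfold mult. simpl. ring.
Qed.

(** Differentiation of a double integral in a parameter. *)
Lemma is_derive_dint (delta rho : R) (m m' : R3 -> R) :
  0 < delta -> 0 < rho ->
  (forall e p, Rabs e < delta -> is_derive (fun u => m (u, p)) e (m' (e, p))) ->
  (forall e p, Rabs e < delta -> continuous m' (e, p)) ->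
  (forall e p, Rabs e < delta -> continuous (fun q => m (e, q)) p) ->
  is_derive (fun e => dint rho (fun p => m (e, p))) 0
    (dint rho (fun p => m' (0, p))).
Proof.
intros Hd Hr Hm Hm' Hc.
assert (Hnear : forall e, Rabs e < delta -> locally e (fun x => Rabs x < delta)).
{ intros e He. apply (open_comp (fun x : R => Rabs x) (fun y => y < delta)).
  - intros x _. apply continuous_Rabs.
  - apply open_lt.
  - exact He. }
assert (H0 : Rabs 0 < delta) by (rewrite Rabs_R0; exact Hd).
assert (Hc3 : forall e s t, Rabs e < delta ->
  continuous (fun p : R * R * R => m' (fst (fst p), mkR2 (snd (fst p)) (snd p)))
    (e, s, t)).
{ intros e s t He.
  apply (continuous_comp
    (fun p : R * R * R => (fst (fst p), mkR2 (snd (fst p)) (snd p)) : R3) m').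
  - apply (continuous_pair (fun p : R * R * R => fst (fst p))
      (fun p => mkR2 (snd (fst p)) (snd p))).
    + apply (continuous_comp (fun p : R * R * R => fst p) fst);
        apply continuous_fst.
    + apply (continuous_pair (fun p : R * R * R => snd (fst p))
        (fun p => snd p)).
      * apply (continuous_comp (fun p : R * R * R => fst p) snd);
          [apply continuous_fst | apply continuous_snd].
      * apply continuous_snd.
  - now apply Hm'. }
assert (Hin : forall e s, Rabs e < delta ->
  is_derive (fun u => RInt (fun t => m (u, mkR2 s t)) (- rho) rho) e
     (RInt (fun t => m' (e, mkR2 s t)) (- rho) rho)).
{ intros e s He.
  apply (is_derive_RInt_cont (fun u t => m (u, mkR2 s t))
    (fun u t => m' (u, mkR2 s t))).
  - lra.
  - generalize (Hnear e He). apply filter_imp. intros x Hx t. now apply Hm.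
  - intros t.
    apply (continuous_comp (fun p : R * R => (fst p, s, snd p))
      (fun p : R * R * R => m' (fst (fst p), mkR2 (snd (fst p)) (snd p)))).
    + apply (continuous_pair (fun p : R * R => (fst p, s)) snd).
      * apply (continuous_pair fst (fun _ => s)).
        -- apply continuous_fst.
        -- apply continuous_const.
      * apply continuous_snd.
    + now apply Hc3.
  - generalize (Hnear e He). apply filter_imp. intros x Hx t.
    apply (continuous_slice2 (fun q : R2 => m (x, q)) s). apply Hc, Hx. }
apply (is_derive_RInt_cont
  (fun e s => RInt (fun t => m (e, mkR2 s t)) (- rho) rho)
  (fun e s => RInt (fun t => m' (e, mkR2 s t)) (- rho) rho)).
- lra.
- generalize (Hnear 0 H0). apply filter_imp. intros x Hx t. now apply Hin.
- intros s.
  apply (continuous_RInt_param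
    (fun (q : R * R) t => m' (fst q, mkR2 (snd q) t))).
  + lra.
  + intros t _. now apply Hc3.
  + assert (Hl : locally (0, s) (fun x : R * R => Rabs (fst x) < delta)).
    { destruct (Hnear 0 H0) as [d Hdd]. exists d. intros x [Hx _].
      now apply Hdd. }
    revert Hl. apply filter_imp. intros [x y] Hx.
    apply (ex_RInt_continuous (V := R_CompleteNormedModule)). intros t _.
    apply (continuous_slice2 (fun q : R * R => m' (x, q)) y).
    apply (continuous_slice2 (T := R_UniformSpace) (U := R2) m' x).
    now apply Hm'.
- generalize (Hnear 0 H0). apply filter_imp. intros x Hx s.
  apply (continuous_RInt_R2 _ _ (fun q => m (x, q))); [lra | ].
  intros p. now apply Hc.
Qed.

(** With [dint_dt], the divergence theorem for a field vanishing on the boundary of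
    the square.  The order of integration is never exchanged: the outer integrand is
    the derivative of the inner integral of P. *)
Lemma dint_ds (rho : R) (P Ps : R2 -> R) :
  0 < rho ->
  (forall p, continuous P p) -> (forall p, continuous Ps p) ->
  (forall s t, is_derive (fun u => P (mkR2 u t)) s (Ps (mkR2 s t))) ->
  (forall t, P (mkR2 rho t) = 0) -> (forall t, P (mkR2 (- rho) t) = 0) ->
  dint rho Ps = 0.
Proof.
intros Hr HP HPs Hd H1 H2.
assert (HI : forall s, is_derive (fun s => RInt (fun t => P (mkR2 s t)) (- rho) rho)
  s (RInt (fun t => Ps (mkR2 s t)) (- rho) rho)).
{ intros s.
  apply (is_derive_RInt_cont (fun s t => P (mkR2 s t)) (fun s t => Ps (mkR2 s t))).
  - lra.
  - apply filter_forall. intros x t. apply Hd.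
  - intros t. apply (continuous_ext Ps); [now intros [u v] | apply HPs].
  - apply filter_forall. intros x t. apply (continuous_slice2 P), HP. }
unfold dint.
rewrite (is_RInt_unique _ _ _ _ (is_RInt_derive _ _ (- rho) rho
  (fun s _ => HI s)
  (fun s _ => continuous_RInt_R2 (- rho) rho Ps ltac:(lra) HPs s))).
rewrite (RInt_ext (fun t => P (mkR2 rho t)) (fun _ => 0)),
  (RInt_ext (fun t => P (mkR2 (- rho) t)) (fun _ => 0)); auto.
apply (minus_eq_zero (G := R_AbelianGroup)).
Qed.

Lemma dint_dt (rho : R) (Q Qt : R2 -> R) :
  (forall p, continuous Qt p) ->
  (forall s t, is_derive (fun u => Q (mkR2 s u)) t (Qt (mkR2 s t))) ->
  (forall s, Q (mkR2 s rho) = 0) -> (forall s, Q (mkR2 s (- rho)) = 0) ->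
  dint rho Qt = 0.
Proof.
intros HQt Hd H1 H2. rewrite <- (dint_zero rho). unfold dint.
apply RInt_ext. intros s _. rewrite RInt_const.
rewrite (is_RInt_unique _ _ _ _ (is_RInt_derive
  (fun t => Q (mkR2 s t)) (fun t => Qt (mkR2 s t)) (- rho) rho
  (fun t _ => Hd s t) (fun t _ => continuous_slice2 Qt s t (HQt (mkR2 s t))))).
rewrite H1, H2. unfold minus, scal, plus, opp. simpl. unfold mult. simpl. ring.
Qed.

(** * Functions of class C^k along lines *)

Section Lines.
Context {E : NormedModule R_AbsRing}.

Lemma line_0 (p X : E) : plus p (scal 0 X) = p.
Proof.
exact (eq_trans (f_equal (plus p) (scal_zero_l (K := R_AbsRing) X))
  (plus_zero_r p)).
Qed.

(** The parametrised line p + h X, re-based at its point of parameter k. *)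
Lemma line_line (p X : E) (h k : R) :
  plus (plus p (scal k X)) (scal (h - k) X) = plus p (scal h X).
Proof.
rewrite <- plus_assoc. f_equal.
refine (eq_trans (eq_sym (scal_distr_r (K := R_AbsRing) k (h - k) X)) _).
f_equal. apply Rplus_minus.
Qed.

Lemma continuous_line (p X : E) (h : R) :
  continuous (fun h : R => plus p (scal h X)) h.
Proof.
apply (continuous_plus (V := E)); [apply continuous_const | ].
apply (continuous_scal_l (K := R_AbsRing) (fun h : R => h)), continuous_id.
Qed.

Lemma open_line (W : E -> Prop) (p X : E) :
  open W -> W p -> locally 0 (fun h : R => W (plus p (scal h X))).
Proof.
intros HW Hp.
apply (continuous_line p X 0). rewrite line_0. now apply HW.
Qed.

Lemma is_derive_line_ext {V : NormedModule R_AbsRing} (W : E -> Prop)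
    (f h : E -> V) (p X : E) (l : V) :
  open W -> W p -> (forall q, W q -> f q = h q) ->
  is_derive (fun x : R => f (plus p (scal x X))) 0 l ->
  is_derive (fun x : R => h (plus p (scal x X))) 0 l.
Proof.
intros HW Hp He. apply is_derive_ext_loc.
generalize (open_line W p X HW Hp). apply filter_imp. intros x Hx.
now apply He.
Qed.

Lemma is_derive_line_shift {V : NormedModule R_AbsRing} (f : E -> V) (p X : E)
    (k : R) (l : V) :
  is_derive (fun x : R => f (plus (plus p (scal k X)) (scal x X))) 0 l ->
  is_derive (fun x : R => f (plus p (scal x X))) k l.
Proof.
intros H.
apply (is_derive_ext (fun x : R =>
  f (plus (plus p (scal k X)) (scal (x - k) X)))).
{ intros x. now rewrite line_line. }
replace l with (scal (1 : R_AbsRing) l) by apply (scal_one l).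
apply (is_derive_comp (fun x : R => f (plus (plus p (scal k X)) (scal x X)))
  (fun x => x - k)).
- now rewrite Rminus_diag.
- auto_derive; [exact I | ring].
Qed.

(** The directional derivative of a real function, the real analogue of [dirD]. *)
Definition dirR (f : E -> R) (p X : E) : R :=
  Derive (fun h : R => f (plus p (scal h X))) 0.

(** The real analogue of [class_C]. *)
Fixpoint classR (k : nat) (U : E -> Prop) (f : E -> R) : Prop :=
  (forall p, U p -> continuous f p) /\
  match k with
  | O => True
  | S k' =>
      forall X : E, exists df : E -> R,
        (forall p, U p ->
           is_derive (fun h : R => f (plus p (scal h X))) 0 (df p)) /\
        classR k' U df
  end.

Lemma classR_cont k U f : classR k U f -> forall p, U p -> continuous f p.
Proof. destruct k; intros [H _]; exact H. Qed.

Lemma classR_pred k : forall U f, classR (S k) U f -> classR k U f.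
Proof.
induction k; intros U f [H1 H2]; split; auto.
intros X. destruct (H2 X) as [df [Hd Hc]]. exists df. split; auto.
Qed.

(** Being of class C^k is local, the local witnesses being allowed to depend on the
    point: the directional derivatives of f furnish global ones. *)
Lemma classR_glue k : forall (U : E -> Prop) (f : E -> R),
  (forall p, U p -> exists (W : E -> Prop) (h : E -> R),
     open W /\ W p /\ (forall q, W q -> f q = h q) /\ classR k W h) ->
  classR k U f.
Proof.
assert (Hcont : forall j (U : E -> Prop) (f : E -> R),
  (forall p, U p -> exists (W : E -> Prop) (h : E -> R),
     open W /\ W p /\ (forall q, W q -> f q = h q) /\ classR j W h) ->
  forall p, U p -> continuous f p).
{ intros j U f H p Hp. destruct (H p Hp) as (W & h & HW & HWp & He & Hc).
  apply (continuous_ext_loc f h).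
  - generalize (HW p HWp). apply filter_imp. intros q Hq. symmetry. auto.
  - now apply (classR_cont j W). }
induction k; intros U f H; split.
- now apply (Hcont O).
- exact I.
- now apply (Hcont (S k)).
- intros X. exists (fun p => dirR f p X).
  assert (Hd : forall p, U p -> exists (W : E -> Prop) (dh : E -> R),
     open W /\ W p /\ (forall q, W q -> is_derive
       (fun x : R => f (plus q (scal x X))) 0 (dh q)) /\ classR k W dh).
  { intros p Hp. destruct (H p Hp) as (W & h & HW & HWp & He & [_ Hc]).
    destruct (Hc X) as (dh & Hdh & Hk). exists W, dh.
    refine (conj HW (conj HWp (conj _ Hk))). intros q Hq.
    apply (is_derive_line_ext W h); auto. intros; symmetry; auto. }
  split.
  + intros p Hp. destruct (Hd p Hp) as (W & dh & HW & HWp & Hdh & _).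
    unfold dirR. rewrite (is_derive_unique _ _ _ (Hdh p HWp)). auto.
  + apply IHk. intros p Hp.
    destruct (Hd p Hp) as (W & dh & HW & HWp & Hdh & Hk).
    exists W, dh. refine (conj HW (conj HWp (conj _ Hk))). intros q Hq.
    now apply is_derive_unique, Hdh.
Qed.

Lemma classR_ext k (U : E -> Prop) f h :
  open U -> (forall q, U q -> f q = h q) -> classR k U f -> classR k U h.
Proof.
intros HU He Hf. apply classR_glue. intros p Hp. exists U, f.
repeat split; auto. intros; symmetry; auto.
Qed.

Lemma classR_sub k : forall (U W : E -> Prop) f,
  (forall q, W q -> U q) -> classR k U f -> classR k W f.
Proof.
induction k; intros U W f HUW [H1 H2]; split; auto.
intros X. destruct (H2 X) as (df & Hd & Hc). exists df. split; auto.
now apply (IHk U).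
Qed.

(** On an open set the derivatives in the definition of [classR] may be taken to be
    [dirR]. *)
Lemma classR_dir k (U : E -> Prop) f X :
  open U -> classR (S k) U f ->
  (forall p, U p ->
     is_derive (fun h : R => f (plus p (scal h X))) 0 (dirR f p X)) /\
  classR k U (fun p => dirR f p X).
Proof.
intros HU [_ Hf]. destruct (Hf X) as (df & Hd & Hc). split.
- intros p Hp. unfold dirR.
  rewrite (is_derive_unique _ _ _ (Hd p Hp)). now apply Hd.
- apply (classR_ext k U df); auto.
  intros q Hq. symmetry. now apply is_derive_unique, Hd.
Qed.

Lemma classR_const k U : forall c, classR k U (fun _ => c).
Proof.
induction k; intros c; split; auto; try (intros; apply continuous_const).
intros X. exists (fun _ => 0). split; [ | apply IHk].
intros p _. apply (is_derive_const (V := R_NormedModule)).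
Qed.

Lemma classR_plus k : forall U f h, classR k U f -> classR k U h ->
  classR k U (fun x => f x + h x).
Proof.
induction k; intros U f h Hf Hh; split; auto;
  try (intros p Hp; apply cont_plus; eapply classR_cont; eassumption).
intros X. destruct (proj2 Hf X) as (df & Hdf & Cf).
destruct (proj2 Hh X) as (dh & Hdh & Ch).
exists (fun p => df p + dh p). split; [ | now apply IHk].
intros p Hp. apply (is_derive_plus (V := R_NormedModule)); auto.
Qed.

Lemma classR_mult k : forall U f h, classR k U f -> classR k U h ->
  classR k U (fun x => f x * h x).
Proof.
induction k; intros U f h Hf Hh; split; auto;
  try (intros p Hp; apply cont_mult; eapply classR_cont; eassumption).
intros X. destruct (proj2 Hf X) as (df & Hdf & Cf).
destruct (proj2 Hh X) as (dh & Hdh & Ch).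
exists (fun p => df p * h p + f p * dh p). split.
- intros p Hp.
  generalize (Derive.is_derive_mult _ _ _ _ _ (Hdf p Hp) (Hdh p Hp)).
  now rewrite !line_0.
- apply classR_plus; apply IHk; auto; now apply classR_pred.
Qed.


Lemma classR_opp k (U : E -> Prop) : forall f,
  classR k U f -> classR k U (fun x => - f x).
Proof.
induction k; intros f Hf; split; auto;
  try (intros p Hp; apply cont_opp; eapply classR_cont; eassumption).
intros X. destruct (proj2 Hf X) as (df & Hdf & Cf).
exists (fun p => - df p). split; [ | now apply IHk].
intros p Hp. apply (is_derive_opp (V := R_NormedModule)); auto.
Qed.

End Lines.

(** * Coordinates on R x R^2 *)

(** The coordinate directions of R^2, and the direction of the parameter eps. *)
Definition e_s : R2 := mkR2 1 0.
Definition e_t : R2 := mkR2 0 1.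
Definition e_eps : R3 := (1, mkR2 0 0).

Lemma R2_line_s (s t h : R) :
  plus (mkR2 s t : R2) (scal h e_s) = mkR2 (s + h) t.
Proof.
change (mkR2 (s + h * 1) (t + h * 0) = mkR2 (s + h) t).
f_equal; ring.
Qed.

Lemma R2_line_t (s t h : R) :
  plus (mkR2 s t : R2) (scal h e_t) = mkR2 s (t + h).
Proof.
change (mkR2 (s + h * 0) (t + h * 1) = mkR2 s (t + h)).
f_equal; ring.
Qed.

Section Slices.
Context {E : NormedModule R_AbsRing}.
Let RE : NormedModule R_AbsRing := prod_NormedModule R_AbsRing R_NormedModule E.

Lemma slice_line (e : R) (p X : E) (h : R) :
  plus ((e, p) : RE) (scal h ((0, X) : RE)) = (e, plus p (scal h X)).
Proof.
change ((e + h * 0, plus p (scal h X)) = (e, plus p (scal h X))).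
f_equal; ring.
Qed.

(** Restriction to the slice of constant first coordinate. *)
Lemma classR_slice (e : R) k : forall (U : RE -> Prop) (f : RE -> R),
  classR k U f -> classR k (fun p => U (e, p)) (fun p => f (e, p)).
Proof.
induction k; intros U f Hf; split; auto;
  try (intros p Hp; apply (continuous_slice2 f), (classR_cont _ _ _ Hf _ Hp)).
intros X. destruct (proj2 Hf (0, X)) as (df & Hd & Hc).
exists (fun p => df (e, p)). split.
- intros p Hp.
  apply (is_derive_ext (fun h : R => f (plus (e, p) (scal h ((0, X) : RE))))).
  + intros h. now rewrite slice_line.
  + now apply Hd.
- now apply IHk.
Qed.

Lemma dirR_slice (f : RE -> R) (e : R) (p X : E) :
  dirR f (e, p) (0, X) = dirR (fun q => f (e, q)) p X.
Proof.
apply Derive_ext. intros h. now rewrite slice_line.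
Qed.

Lemma open_strip (delta : R) : open (fun x : RE => Rabs (fst x) < delta).
Proof.
apply (open_comp (fun x : RE => Rabs (fst x)) (fun y => y < delta)).
- intros x _. apply (continuous_comp (fun x : RE => fst x) Rabs).
  + destruct x. apply continuous_fst.
  + apply continuous_Rabs.
- apply open_lt.
Qed.
End Slices.

Lemma is_derive_eps (f : R3 -> R) (e : R) (p : R2) (l : R) :
  is_derive (fun h : R => f (plus ((e, p) : R3) (scal h e_eps))) 0 l ->
  is_derive (fun u : R => f (u, p)) e l.
Proof.
assert (Hl : forall u h, plus ((u, p) : R3) (scal h e_eps) = (u + h, p)).
{ intros u h. destruct p as [s t]. change R in s. change R in t.
  change ((u + h * 1, (s + h * 0, t + h * 0)) = (u + h, (s, t))).
  now replace (u + h * 1) with (u + h) by ring;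
    replace (s + h * 0) with s by ring; replace (t + h * 0) with t by ring. }
intros H.
apply (is_derive_ext (fun h : R => f (plus ((0, p) : R3) (scal h e_eps)))).
{ intros h. now rewrite Hl, Rplus_0_l. }
apply is_derive_line_shift. now rewrite Hl, Rplus_0_l.
Qed.

Lemma is_derive_s (f : R2 -> R) (s t l : R) :
  is_derive (fun h : R => f (plus (mkR2 s t) (scal h e_s))) 0 l ->
  is_derive (fun u : R => f (mkR2 u t)) s l.
Proof.
intros H.
apply (is_derive_ext (fun h : R => f (plus (mkR2 0 t) (scal h e_s)))).
{ intros h. now rewrite R2_line_s, Rplus_0_l. }
apply is_derive_line_shift. now rewrite R2_line_s, Rplus_0_l.
Qed.

Lemma is_derive_t (f : R2 -> R) (s t l : R) :
  is_derive (fun h : R => f (plus (mkR2 s t) (scal h e_t))) 0 l ->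
  is_derive (fun u : R => f (mkR2 s u)) t l.
Proof.
intros H.
apply (is_derive_ext (fun h : R => f (plus (mkR2 s 0) (scal h e_t)))).
{ intros h. now rewrite R2_line_t, Rplus_0_l. }
apply is_derive_line_shift. now rewrite R2_line_t, Rplus_0_l.
Qed.

(** * First variation of the Dirichlet energy *)

(** A continuous function that vanishes for |x| > rho vanishes at +- rho. *)
Lemma zero_boundary (f : R -> R) (rho : R) :
  (forall x, continuous f x) -> (forall x, rho < Rabs x -> f x = 0) ->
  0 < rho -> f rho = 0 /\ f (- rho) = 0.
Proof.
intros Hc Hz Hr.
assert (H : forall h : R -> R, continuous h rho ->
  (forall x, rho < x -> h x = 0) -> h rho = 0).
{ intros h Hh Hzh. destruct (Req_dec (h rho) 0) as [E | E]; [exact E | exfalso].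
  assert (Hp : 0 < Rabs (h rho)) by now apply Rabs_pos_lt.
  apply filterlim_locally with (eps := mkposreal _ Hp) in Hh.
  destruct Hh as [d Hd]. specialize (Hd (rho + d / 2)).
  assert (Hdp := cond_pos d).
  assert (Hb : ball rho d (rho + d / 2)).
  { change (Rabs (rho + d / 2 - rho) < d).
    rewrite Rabs_pos_eq; lra. }
  specialize (Hd Hb). rewrite Hzh in Hd by lra.
  change (Rabs (0 - h rho) < Rabs (h rho)) in Hd.
  rewrite Rminus_0_l, Rabs_Ropp in Hd. lra. }
split.
- apply H; auto. intros x Hx. apply Hz. rewrite Rabs_pos_eq; lra.
- apply (H (fun x => f (- x))).
  + apply (continuous_comp Ropp f); auto.
    apply cont_opp, continuous_id.
  + intros x Hx. apply Hz. rewrite Rabs_Ropp, Rabs_pos_eq; lra.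
Qed.

(** The flat Laplacian of a real function. *)
Definition lapR (f : R2 -> R) (p : R2) : R :=
  dirR (fun q => dirR f q e_s) p e_s + dirR (fun q => dirR f q e_t) p e_t.

(** [e] is a density on R^2 depending on a parameter, continuous in the point when
    the parameter is less than [delta] in absolute value, and the derivative at 0 of
    its integral over the square is the integral of the continuous function [n].
    The continuity clauses make the notion additive. *)
Definition first_variation (delta rho : R) (e : R3 -> R) (n : R2 -> R) : Prop :=
  (forall x p, Rabs x < delta -> continuous (fun q => e (x, q)) p) /\
  (forall p, continuous n p) /\
  is_derive (fun x => dint rho (fun p => e (x, p))) 0 (dint rho n).

Lemma locally_Rabs_lt (delta : R) :
  0 < delta -> locally 0 (fun x => Rabs x < delta).
Proof.
intros Hd. exists (mkposreal _ Hd). intros x Hx.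
replace x with (x - 0) by ring. exact Hx.
Qed.

Lemma first_variation_ext delta rho e e' n n' :
  0 < delta ->
  (forall x p, Rabs x < delta -> e (x, p) = e' (x, p)) ->
  (forall p, n p = n' p) ->
  first_variation delta rho e n -> first_variation delta rho e' n'.
Proof.
intros Hd He Hn (H1 & H2 & H3). split; [ | split].
- intros x p Hx. apply (continuous_ext (fun q => e (x, q))); auto.
- intros p. apply (continuous_ext n); auto.
- rewrite <- (dint_ext rho n n' Hn).
  revert H3. apply is_derive_ext_loc.
  generalize (locally_Rabs_lt delta Hd). apply filter_imp. intros x Hx.
  apply dint_ext. intros p. now apply He.
Qed.

Lemma first_variation_plus delta rho e e' n n' :
  0 < delta -> 0 < rho ->
  first_variation delta rho e n -> first_variation delta rho e' n' ->
  first_variation delta rho (fun x => e x + e' x) (fun p => n p + n' p).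
Proof.
intros Hd Hr (H1 & H2 & H3) (H1' & H2' & H3'). split; [ | split].
- intros x p Hx. apply cont_plus; auto.
- intros p. apply cont_plus; auto.
- rewrite dint_plus; auto.
  apply (is_derive_ext_loc
    (fun x => dint rho (fun p => e (x, p)) + dint rho (fun p => e' (x, p)))).
  + generalize (locally_Rabs_lt delta Hd). apply filter_imp. intros x Hx.
    symmetry. apply dint_plus; auto.
  + apply (is_derive_plus (V := R_NormedModule)); auto.
Qed.

Lemma first_variation_scal delta rho k e n :
  0 < delta -> 0 < rho ->
  first_variation delta rho e n ->
  first_variation delta rho (fun x => k * e x) (fun p => k * n p).
Proof.
intros Hd Hr (H1 & H2 & H3). split; [ | split].
- intros x p Hx. apply cont_mult; auto. apply continuous_const.
- intros p. apply cont_mult; auto. apply continuous_const.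
- rewrite dint_scal; auto.
  apply (is_derive_ext_loc (fun x => k * dint rho (fun p => e (x, p)))).
  + generalize (locally_Rabs_lt delta Hd). apply filter_imp. intros x Hx.
    symmetry. apply dint_scal; auto.
  + now apply is_derive_scal.
Qed.

Lemma is_derive_squares (f h k : R -> R) (x df dh dk a b c d : R) :
  is_derive f x df -> is_derive h x dh -> is_derive k x dk ->
  is_derive (fun u => (h u - a) * (h u - a) + (k u - b) * (k u - b) +
      d * (f u - c)) x
    (2 * dh * (h x - a) + 2 * dk * (k x - b) + d * df).
Proof.
intros Hf Hh Hk. auto_derive.
- repeat split; eexists; eassumption.
- replace (Derive (fun y => f y) x) with df
    by (symmetry; now apply is_derive_unique).
  replace (Derive (fun y => h y) x) with dh
    by (symmetry; now apply is_derive_unique).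
  replace (Derive (fun y => k y) x) with dk
    by (symmetry; now apply is_derive_unique).
  ring.
Qed.

(** The derivative at parameter 0 of the integral of
    (h - h0)^2 + (k - k0)^2 + l (f - f0). *)
Lemma is_derive_dint_remainder (delta rho : R) (f h k df dh dk : R3 -> R)
    (f0 h0 k0 l : R2 -> R) :
  0 < delta -> 0 < rho ->
  (forall x p, Rabs x < delta ->
     (continuous f (x, p) /\ continuous h (x, p) /\ continuous k (x, p)) /\
     (continuous df (x, p) /\ continuous dh (x, p) /\ continuous dk (x, p)) /\
     is_derive (fun u => f (u, p)) x (df (x, p)) /\
     is_derive (fun u => h (u, p)) x (dh (x, p)) /\
     is_derive (fun u => k (u, p)) x (dk (x, p))) ->
  (forall p, continuous f0 p /\ continuous h0 p /\ continuous k0 p /\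
     continuous l p) ->
  let m := fun x : R3 => (h x - h0 (snd x)) * (h x - h0 (snd x)) +
      (k x - k0 (snd x)) * (k x - k0 (snd x)) +
      l (snd x) * (f x - f0 (snd x)) in
  (forall x p, Rabs x < delta -> continuous (fun q => m (x, q)) p) /\
  is_derive (fun x => dint rho (fun p => m (x, p))) 0
    (dint rho (fun p => 2 * dh (0, p) * (h (0, p) - h0 p) +
      2 * dk (0, p) * (k (0, p) - k0 p) + l p * df (0, p))).
Proof.
intros Hd Hr H H0 m.
assert (Hm : forall x p, Rabs x < delta -> continuous (fun q => m (x, q)) p).
{ intros x p Hx. unfold m. simpl.
  destruct (H x p Hx) as ((C1 & C2 & C3) & _).
  destruct (H0 p) as (C1' & C2' & C3' & Cl).
  apply (continuous_slice2 f) in C1. apply (continuous_slice2 h) in C2.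
  apply (continuous_slice2 k) in C3.
  refine (cont_plus _ _ _ (cont_plus _ _ _ (cont_mult _ _ _ _ _)
    (cont_mult _ _ _ _ _)) (cont_mult _ _ _ Cl _)); apply cont_minus; assumption. }
split; [exact Hm | ].
apply (is_derive_dint delta rho m (fun x => 2 * dh x * (h x - h0 (snd x)) +
      2 * dk x * (k x - k0 (snd x)) + l (snd x) * df x)); auto.
- intros x p Hx. destruct (H x p Hx) as (_ & _ & D1 & D2 & D3).
  unfold m. simpl.
  apply (is_derive_squares (fun u => f (u, p)) (fun u => h (u, p))
      (fun u => k (u, p))); assumption.
- intros x p Hx. destruct (H x p Hx) as ((C1 & C2 & C3) & (E1 & E2 & E3) & _).
  destruct (H0 p) as (C1' & C2' & C3' & Cl).
  assert (Hsnd : forall u : R2 -> R, continuous u p ->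
    continuous (fun x : R3 => u (snd x)) (x, p)).
  { intros u Hu. apply (continuous_comp (fun x : R3 => snd x) u); auto.
    apply continuous_snd. }
  apply Hsnd in C2'. apply Hsnd in C3'. apply Hsnd in Cl.
  refine (cont_plus _ _ _ (cont_plus _ _ _ (cont_mult _ _ _ (cont_mult _ _ _ _ E2) _)
    (cont_mult _ _ _ (cont_mult _ _ _ _ E3) _)) (cont_mult _ _ _ Cl E1));
    first [apply continuous_const | apply cont_minus; assumption].
Qed.

(** First variation of the Dirichlet energy of a real function. *)
Theorem first_variation_dirichlet (delta rho : R) (G : R3 -> R) :
  0 < delta -> 0 < rho ->
  classR 2 (fun x : R3 => Rabs (fst x) < delta) G ->
  (forall x s t, Rabs x < delta -> rho < Rabs s \/ rho < Rabs t ->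
     G (x, mkR2 s t) = G (0, mkR2 s t)) ->
  first_variation delta rho
    (fun x => dirR (fun q => G (fst x, q)) (snd x) e_s ^ 2 +
              dirR (fun q => G (fst x, q)) (snd x) e_t ^ 2)
    (fun p => - 2 * (lapR (fun q => G (0, q)) p * dirR G (0, p) e_eps)).
Proof.
intros Hd Hr HG Hsupp.
set (U := fun x : R3 => Rabs (fst x) < delta) in *.
assert (HU : open U) by apply open_strip.
assert (U0 : forall p, U (0, p)) by (intros p; unfold U; simpl; now rewrite Rabs_R0).
set (G0 := fun p : R2 => G (0, p)).
set (A := fun _ : R2 => True).
assert (HA : open A) by apply open_all.
assert (HG0 : classR 2 A G0).
{ apply (classR_sub 2 (fun p => U (0, p))); [auto | ].
  apply classR_slice, HG. }
destruct (classR_dir 1 U G (0, e_s) HU HG) as [Ds Cs].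
destruct (classR_dir 1 U G (0, e_t) HU HG) as [Dt Ct].
destruct (classR_dir 1 U G e_eps HU HG) as [De Ce].
destruct (classR_dir 0 U _ e_eps HU Cs) as [Dse Cse].
destruct (classR_dir 0 U _ e_eps HU Ct) as [Dte Cte].
destruct (classR_dir 1 A G0 e_s HA HG0) as [D0s C0s].
destruct (classR_dir 1 A G0 e_t HA HG0) as [D0t C0t].
destruct (classR_dir 0 A _ e_s HA C0s) as [D0ss C0ss].
destruct (classR_dir 0 A _ e_t HA C0t) as [D0tt C0tt].
set (Gs := fun x : R3 => dirR G x (0, e_s)) in *.
set (Gt := fun x : R3 => dirR G x (0, e_t)) in *.
set (Ge := fun x : R3 => dirR G x e_eps) in *.
set (Gse := fun x : R3 => dirR Gs x e_eps) in *.
set (Gte := fun x : R3 => dirR Gt x e_eps) in *.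
set (Gs0 := fun p => dirR G0 p e_s) in *.
set (Gt0 := fun p => dirR G0 p e_t) in *.
set (Gss0 := fun p => dirR Gs0 p e_s) in *.
set (Gtt0 := fun p => dirR Gt0 p e_t) in *.
assert (EGs : forall x p, Gs (x, p) = dirR (fun q => G (x, q)) p e_s)
  by (intros x p; exact (dirR_slice G x p _)).
assert (EGt : forall x p, Gt (x, p) = dirR (fun q => G (x, q)) p e_t)
  by (intros x p; exact (dirR_slice G x p _)).
assert (Kslice : forall f : R3 -> R, (forall x, U x -> continuous f x) ->
   forall x p, Rabs x < delta -> continuous (fun q => f (x, q)) p).
{ intros f Hf x p Hx. apply (continuous_slice2 f), Hf, Hx. }
assert (KG := classR_cont _ _ _ HG).
assert (KGs := classR_cont _ _ _ Cs).
assert (KGt := classR_cont _ _ _ Ct).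
assert (KGe := classR_cont _ _ _ Ce).
assert (KGse := classR_cont _ _ _ Cse).
assert (KGte := classR_cont _ _ _ Cte).
assert (KG0 : forall p, continuous G0 p)
  by (intros p; now apply (classR_cont _ _ _ HG0)).
assert (KGs0 : forall p, continuous Gs0 p)
  by (intros p; now apply (classR_cont _ _ _ C0s)).
assert (KGt0 : forall p, continuous Gt0 p)
  by (intros p; now apply (classR_cont _ _ _ C0t)).
assert (KGss0 : forall p, continuous Gss0 p)
  by (intros p; now apply (classR_cont _ _ _ C0ss)).
assert (KGtt0 : forall p, continuous Gtt0 p)
  by (intros p; now apply (classR_cont _ _ _ C0tt)).
set (e := fun x : R3 => Gs x * Gs x + Gt x * Gt x).
assert (Kec : forall x p, Rabs x < delta -> continuous (fun q => e (x, q)) p).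
{ intros x p Hx.
  exact (cont_plus _ _ _
    (cont_mult _ _ _ (Kslice Gs KGs x p Hx) (Kslice Gs KGs x p Hx))
    (cont_mult _ _ _ (Kslice Gt KGt x p Hx) (Kslice Gt KGt x p Hx))). }
set (m := fun x : R3 =>
  (Gs x - Gs0 (snd x)) * (Gs x - Gs0 (snd x)) +
  (Gt x - Gt0 (snd x)) * (Gt x - Gt0 (snd x)) +
  - 2 * (Gss0 (snd x) + Gtt0 (snd x)) * (G x - G0 (snd x))).
(* The remainder |dH|^2 - 2 (Delta G_0) H; its derivative at 0 is
   linear in dG/deps because dH vanishes there. *)
destruct (is_derive_dint_remainder delta rho G Gs Gt Ge Gse Gte G0 Gs0 Gt0
  (fun p => - 2 * (Gss0 p + Gtt0 p))) as [Hmc Hmd]; auto.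
{ intros x p Hx. split; [ | split]; auto. split; [ | split].
  - apply is_derive_eps. now apply De.
  - apply is_derive_eps. exact (Dse (x, p) Hx).
  - apply is_derive_eps. exact (Dte (x, p) Hx). }
{ intros p. repeat (split; auto).
  apply cont_mult; [apply continuous_const | apply cont_plus; auto]. }
change (is_derive (fun x => dint rho (fun p => m (x, p))) 0 (dint rho (fun p =>
  2 * Gse (0, p) * (Gs (0, p) - Gs0 p) + 2 * Gte (0, p) * (Gt (0, p) - Gt0 p) +
  - 2 * (Gss0 p + Gtt0 p) * Ge (0, p)))) in Hmd.
change (forall x p, Rabs x < delta -> continuous (fun q => m (x, q)) p) in Hmc.
assert (E0s : forall p, Gs (0, p) = Gs0 p) by (intros p; apply EGs).
assert (E0t : forall p, Gt (0, p) = Gt0 p) by (intros p; apply EGt).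
split; [ | split].
- intros x p Hx. apply (continuous_ext (fun q => e (x, q))).
  + intros q.
    change (e (x, q) = dirR (fun q : R2 => G (x, q)) q e_s ^ 2 +
      dirR (fun q : R2 => G (x, q)) q e_t ^ 2).
    rewrite <- EGs, <- EGt. unfold e. simpl. now rewrite !Rmult_1_r.
  + now apply Kec.
- intros p. unfold lapR. apply cont_mult; [apply continuous_const | ].
  apply cont_mult.
  + apply cont_plus; auto.
  + apply (continuous_slice2 Ge), KGe, U0.
- match type of Hmd with is_derive _ _ (dint _ ?f) =>
    rewrite (dint_ext rho _ f); [set (m' := f) in Hmd |- * | ] end.
  2: { intros p.
       assert (Haux : forall a b c a' b' d, - 2 * (c * d) =
         2 * a' * (a - a) + 2 * b' * (b - b) + - 2 * c * d) by (intros; ring).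
       rewrite E0s, E0t. exact (Haux (Gs0 p) (Gt0 p) (Gss0 p + Gtt0 p)
         (Gse (0, p)) (Gte (0, p)) (Ge (0, p))). }
  apply (is_derive_ext_loc (fun x =>
    dint rho (fun p => e (0, p)) + dint rho (fun p => m (x, p)))).
  2: { replace (dint rho m') with (0 + dint rho m') by ring.
       apply (is_derive_plus (V := R_NormedModule)); auto.
       apply (is_derive_const (V := R_NormedModule)). }
  generalize (locally_Rabs_lt delta Hd). apply filter_imp. intros x Hx.
  set (H := fun p => G (x, p) - G0 p).
  set (Hs := fun p => Gs (x, p) - Gs0 p).
  set (Ht := fun p => Gt (x, p) - Gt0 p).
  assert (KH : forall p, continuous H p)
    by (intros p; apply cont_minus; auto).
  assert (KHs : forall p, continuous Hs p)
    by (intros p; apply cont_minus; auto).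
  assert (KHt : forall p, continuous Ht p)
    by (intros p; apply cont_minus; auto).
  assert (Hbs : forall t, H (mkR2 rho t) = 0 /\ H (mkR2 (- rho) t) = 0).
  { intros t. apply (zero_boundary (fun s => H (mkR2 s t))); auto.
    - intros s. apply (continuous_comp (fun s => mkR2 s t) H); auto.
      apply (continuous_pair (fun s : R => s) (fun _ => t));
        [apply continuous_id | apply continuous_const].
    - intros s Hs'. apply Rminus_diag_eq, Hsupp; auto. }
  assert (Hbt : forall s, H (mkR2 s rho) = 0 /\ H (mkR2 s (- rho)) = 0).
  { intros s. apply (zero_boundary (fun t => H (mkR2 s t))); auto.
    - intros t. apply (continuous_slice2 H s), KH.
    - intros t Hs'. apply Rminus_diag_eq, Hsupp; auto. }
  (* The two terms of the divergence of H grad G_0. *)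
  set (Ps := fun p => Gss0 p * H p + Gs0 p * Hs p).
  set (Qt := fun p => Gtt0 p * H p + Gt0 p * Ht p).
  assert (KPs : forall p, continuous Ps p)
    by (intros p; apply cont_plus; apply cont_mult; auto).
  assert (KQt : forall p, continuous Qt p)
    by (intros p; apply cont_plus; apply cont_mult; auto).
  assert (HPs : dint rho Ps = 0).
  { apply (dint_ds rho (fun p => Gs0 p * H p)); auto.
    - intros p. apply cont_mult; auto.
    - intros s t. apply Derive.is_derive_mult.
      + apply is_derive_s. exact (D0ss (mkR2 s t) I).
      + apply (is_derive_minus (V := R_NormedModule)).
        * apply (is_derive_s (fun p => G (x, p))).
          rewrite EGs. apply (is_derive_ext (fun h : R =>
            G (plus (x, mkR2 s t) (scal h ((0, e_s) : R3))))).
          -- intros h. now rewrite (slice_line (E := R2)).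
          -- rewrite <- EGs. now apply Ds.
        * apply is_derive_s. exact (D0s (mkR2 s t) I).
    - intros t. replace (H (mkR2 rho t)) with 0; [ring | symmetry].
      apply Hbs.
    - intros t. replace (H (mkR2 (- rho) t)) with 0; [ring | symmetry].
      apply Hbs. }
  assert (HQt : dint rho Qt = 0).
  { apply (dint_dt rho (fun p => Gt0 p * H p)); auto.
    - intros s t. apply Derive.is_derive_mult.
      + apply is_derive_t. exact (D0tt (mkR2 s t) I).
      + apply (is_derive_minus (V := R_NormedModule)).
        * apply (is_derive_t (fun p => G (x, p))).
          rewrite EGt. apply (is_derive_ext (fun h : R =>
            G (plus (x, mkR2 s t) (scal h ((0, e_t) : R3))))).
          -- intros h. now rewrite (slice_line (E := R2)).
          -- rewrite <- EGt. now apply Dt.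
        * apply is_derive_t. exact (D0t (mkR2 s t) I).
    - intros s. replace (H (mkR2 s rho)) with 0; [ring | symmetry].
      apply Hbt.
    - intros s. replace (H (mkR2 s (- rho))) with 0; [ring | symmetry].
      apply Hbt. }
  assert (Ke0 : forall p, continuous (fun q => e (0, q)) p).
  { intros p. apply Kec. now rewrite Rabs_R0. }
  assert (Kmx : forall p, continuous (fun q => m (x, q)) p) by auto.
  match goal with |- ?a = ?b => change (@eq R a b) end.
  transitivity (dint rho (fun p => e (0, p) + m (x, p) + (2 * Ps p + 2 * Qt p))).
  + rewrite !dint_plus; auto.
    * rewrite !dint_scal; auto. rewrite HPs, HQt, Rmult_0_r, !Rplus_0_r. reflexivity.
    * intros p. apply cont_mult; auto. apply continuous_const.
    * intros p. apply cont_mult; auto. apply continuous_const.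
    * intros p. apply cont_plus; auto.
    * intros p. apply cont_plus; apply cont_mult; auto; apply continuous_const.
  + apply dint_ext. intros p.
    change (e (0, p) + m (x, p) + (2 * Ps p + 2 * Qt p) =
      dirR (fun q : R2 => G (x, q)) p e_s ^ 2 +
      dirR (fun q : R2 => G (x, q)) p e_t ^ 2).
    rewrite <- EGs, <- EGt.
    assert (Haux : forall a b a0 b0 c c0 d d', a0 * a0 + b0 * b0 +
      ((a - a0) * (a - a0) + (b - b0) * (b - b0) + - 2 * (d + d') * (c - c0)) +
      (2 * (d * (c - c0) + a0 * (a - a0)) + 2 * (d' * (c - c0) + b0 * (b - b0)))
      = a ^ 2 + b ^ 2) by (intros; ring).
    specialize (Haux (Gs (x, p)) (Gt (x, p)) (Gs0 p) (Gt0 p) (G (x, p)) (G0 p)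
      (Gss0 p) (Gtt0 p)).
    unfold e. rewrite E0s, E0t. exact Haux.
Qed.

(** * Maps into C^3 and their coordinates *)

Lemma is_derive_linear {V W : NormedModule R_AbsRing} (c : V -> W)
    (f : R -> V) (x : R) (l : V) :
  is_linear c -> is_derive f x l -> is_derive (fun y => c (f y)) x (c l).
Proof.
intros Hc Hf.
apply (filterdiff_ext_lin _ (fun y : R => c (scal y l))).
- apply (filterdiff_comp f c _ c Hf).
  now apply filterdiff_linear.
- intros y. apply (linear_scal c Hc).
Qed.

Lemma is_derive_pair {V W : NormedModule R_AbsRing} (f : R -> V) (h : R -> W)
    (x : R) (l : V) (k : W) :
  is_derive f x l -> is_derive h x k ->
  is_derive (V := prod_NormedModule R_AbsRing V W) (fun y => (f y, h y)) x (l, k).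
Proof.
intros Hf Hh.
apply (filterdiff_comp_2 (W := prod_NormedModule R_AbsRing V W)
  f h (fun a b => (a, b)) (fun y => scal y l) (fun y => scal y k)
  (fun a b => (a, b)) Hf Hh).
apply filterdiff_linear. split.
- now intros [a b] [a' b'].
- now intros r [a b].
- exists 1. split; [lra | ]. intros [a b]. rewrite Rmult_1_l. apply Rle_refl.
Qed.

(** The six real coordinates of C^3.  Statements quantified over [coords] transfer
    results on real functions to maps into C^3. *)
Definition re1 (x : C3) : R := Re (co1 x).
Definition im1 (x : C3) : R := Im (co1 x).
Definition re2 (x : C3) : R := Re (co2 x).
Definition im2 (x : C3) : R := Im (co2 x).
Definition re3 (x : C3) : R := Re (co3 x).
Definition im3 (x : C3) : R := Im (co3 x).
Definition coords : list (C3 -> R) := [re1; im1; re2; im2; re3; im3].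

Lemma forall_coords (P : (C3 -> R) -> Prop) :
  (forall c, In c coords -> P c) <->
  (P re1 /\ P im1) /\ (P re2 /\ P im2) /\ (P re3 /\ P im3).
Proof.
unfold coords. split.
- intros H. repeat split; apply H; simpl; tauto.
- intros ((H1 & H2) & (H3 & H4) & (H5 & H6)) c Hc. simpl in Hc.
  decompose [or] Hc; subst; easy.
Qed.

Lemma C3_eq (x y : C3) : (forall c, In c coords -> c x = c y) -> x = y.
Proof.
intros H. rewrite (forall_coords (fun c => c x = c y)) in H.
destruct x as [[[? ?] [? ?]] [? ?]]. destruct y as [[[? ?] [? ?]] [? ?]].
unfold re1, im1, re2, im2, re3, im3, co1, co2, co3 in H. simpl in H.
destruct H as ((-> & ->) & (-> & ->) & -> & ->). reflexivity.
Qed.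

Lemma is_linear_coord c : In c coords ->
  is_linear (U := C3) (V := R_NormedModule) c.
Proof.
revert c. apply forall_coords.
assert (Hf := @is_linear_fst R_AbsRing). assert (Hs := @is_linear_snd R_AbsRing).
assert (L1 : is_linear (U := C3) (V := C_R_NormedModule) co1)
  by (apply (is_linear_comp fst fst); [apply Hf | apply Hf]).
assert (L2 : is_linear (U := C3) (V := C_R_NormedModule) co2)
  by (apply (is_linear_comp fst snd); [apply Hf | apply Hs]).
assert (L3 : is_linear (U := C3) (V := C_R_NormedModule) co3) by apply Hs.
repeat split.
all: first
  [ apply (is_linear_comp co1 (fst : C -> R) L1 (Hf R_NormedModule R_NormedModule))
  | apply (is_linear_comp co1 (snd : C -> R) L1 (Hs R_NormedModule R_NormedModule))
  | apply (is_linear_comp co2 (fst : C -> R) L2 (Hf R_NormedModule R_NormedModule))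
  | apply (is_linear_comp co2 (snd : C -> R) L2 (Hs R_NormedModule R_NormedModule))
  | apply (is_linear_comp co3 (fst : C -> R) L3 (Hf R_NormedModule R_NormedModule))
  | apply (is_linear_comp co3 (snd : C -> R) L3 (Hs R_NormedModule R_NormedModule))
  ].
Qed.

Lemma is_deriveC_parts (f : R -> C) (x : R) (l : C) :
  is_deriveC f x l <->
  is_derive (fun y => Re (f y)) x (Re l) /\ is_derive (fun y => Im (f y)) x (Im l).
Proof.
split.
- intros H. split.
  + apply (is_derive_linear (V := C_R_NormedModule) (W := R_NormedModule) fst
      f x l (@is_linear_fst R_AbsRing _ _) H).
  + apply (is_derive_linear (V := C_R_NormedModule) (W := R_NormedModule) snd
      f x l (@is_linear_snd R_AbsRing _ _) H).
- intros [H1 H2].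
  generalize (is_derive_pair _ _ _ _ _ H1 H2).
  intros H. destruct l.
  apply (is_derive_ext (V := C_R_NormedModule) (fun y => (Re (f y), Im (f y)))).
  + intros t. now destruct (f t).
  + exact H.
Qed.

Lemma is_derive3_parts (f : R -> C3) (x : R) (l : C3) :
  is_derive3 f x l <->
  is_deriveC (fun y => co1 (f y)) x (co1 l) /\
  is_deriveC (fun y => co2 (f y)) x (co2 l) /\
  is_deriveC (fun y => co3 (f y)) x (co3 l).
Proof.
assert (Hf := @is_linear_fst R_AbsRing). assert (Hs := @is_linear_snd R_AbsRing).
split.
- intros H. split; [ | split].
  + apply (is_derive_linear (V := C3) (W := C_R_NormedModule) co1); auto.
    apply (is_linear_comp fst fst); [apply Hf | apply Hf].
  + apply (is_derive_linear (V := C3) (W := C_R_NormedModule) co2); auto.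
    apply (is_linear_comp fst snd); [apply Hf | apply Hs].
  + apply (is_derive_linear (V := C3) (W := C_R_NormedModule) co3); auto.
    apply Hs.
- intros (H1 & H2 & H3). destruct l as [[l1 l2] l3].
  apply (is_derive_ext (V := C3) (fun y => (co1 (f y), co2 (f y), co3 (f y)))).
  + intros t. now destruct (f t) as [[a b] c].
  + apply (is_derive_pair (V := prod_NormedModule _ C_R_NormedModule
      C_R_NormedModule) (W := C_R_NormedModule)
      (fun y => (co1 (f y), co2 (f y))) (fun y => co3 (f y)) x (l1, l2) l3); auto.
    now apply (is_derive_pair (V := C_R_NormedModule) (W := C_R_NormedModule)).
Qed.

Lemma is_derive3_coords (f : R -> C3) (x : R) (l : C3) :
  (forall c, In c coords -> is_derive (fun y => c (f y)) x (c l)) <->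
  is_derive3 f x l.
Proof.
rewrite (forall_coords (fun c => is_derive (fun y => c (f y)) x (c l))).
rewrite is_derive3_parts, !is_deriveC_parts. reflexivity.
Qed.

Lemma continuous_coords {T : UniformSpace} (f : T -> C3) (p : T) :
  (forall c, In c coords -> continuous (fun q => c (f q)) p) ->
  continuous f p.
Proof.
intros H.
rewrite (forall_coords (fun c => continuous (fun q => c (f q)) p)) in H.
destruct H as ((H1 & H2) & (H3 & H4) & H5 & H6).
assert (H := continuous_pair _ _ _ (continuous_pair _ _ _
   (continuous_pair _ _ _ H1 H2) (continuous_pair _ _ _ H3 H4))
   (continuous_pair _ _ _ H5 H6)).
apply (continuous_ext (U := C3) (fun q =>
  (re1 (f q), im1 (f q), (re2 (f q), im2 (f q)), (re3 (f q), im3 (f q))))).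
- intros q. now destruct (f q) as [[[? ?] [? ?]] [? ?]].
- exact H.
Qed.

Section Comps.
Context {E : NormedModule R_AbsRing}.

Lemma class_C_coord k : forall (U : E -> Prop) (f : E -> C3) c,
  In c coords -> class_C k U f -> classR k U (fun p => c (f p)).
Proof.
assert (Hcont : forall (f : E -> C3) p c, In c coords -> continuous f p ->
  continuous (fun p => c (f p)) p).
{ intros f p c Hc Hf. apply (continuous_comp f c); auto.
  apply (linear_cont (c : C3 -> R_NormedModule)). now apply is_linear_coord. }
induction k; intros U f c Hc [H1 H2]; split; auto.
intros X. destruct (H2 X) as (df & Hd & Hk).
exists (fun p => c (df p)). split; auto.
intros p Hp. apply (is_derive_linear (V := C3) (W := R_NormedModule) c); auto.
now apply is_linear_coord.
Qed.

Lemma coord_dirD c (f : E -> C3) p X :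
  In c coords -> c (dirD f p X) = dirR (fun p => c (f p)) p X.
Proof.
revert c.
apply (forall_coords (fun c => c (dirD f p X) = dirR (fun p => c (f p)) p X)).
repeat split; reflexivity.
Qed.

Lemma class_C_coords k : forall (U : E -> Prop) (f : E -> C3),
  open U ->
  (forall c, In c coords -> classR k U (fun p => c (f p))) -> class_C k U f.
Proof.
induction k; intros U f HU H; split; auto.
- intros p Hp. apply continuous_coords. intros c Hc.
  now apply (classR_cont _ _ _ (H c Hc)).
- intros p Hp. apply continuous_coords. intros c Hc.
  now apply (classR_cont _ _ _ (H c Hc)).
- intros X. exists (fun p => dirD f p X).
  split.
  + intros p Hp. apply is_derive3_coords. intros c Hc. rewrite coord_dirD; auto.
    now apply (classR_dir k U (fun p => c (f p)) X HU (H c Hc)).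
  + apply IHk; auto. intros c Hc.
    apply (classR_ext k U (fun p => dirR (fun p => c (f p)) p X)); auto.
    * intros q _. symmetry. now apply coord_dirD.
    * now apply (classR_dir k U (fun p => c (f p)) X HU (H c Hc)).
Qed.

Lemma is_derive3_dirD (f : E -> C3) p X l :
  is_derive3 (fun h : R => f (plus p (scal h X))) 0 l -> dirD f p X = l.
Proof.
intros H. apply C3_eq. intros c Hc. rewrite coord_dirD; auto.
apply is_derive_unique. now apply (proj2 (is_derive3_coords _ _ _) H).
Qed.

Lemma class_C_derive k (U : E -> Prop) (f : E -> C3) p X :
  class_C (S k) U f -> U p ->
  is_derive3 (fun h : R => f (plus p (scal h X))) 0 (dirD f p X).
Proof.
intros [_ H] Hp. destruct (H X) as (df & Hd & _).
rewrite (is_derive3_dirD f p X (df p) (Hd p Hp)). now apply Hd.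
Qed.

Lemma dirD_local (W : E -> Prop) (f h : E -> C3) p X :
  open W -> W p -> (forall q, W q -> f q = h q) -> dirD f p X = dirD h p X.
Proof.
intros HW Hp He.
assert (HL : locally 0 (fun x : R => f (plus p (scal x X)) = h (plus p (scal x X)))).
{ generalize (open_line W p X HW Hp). apply filter_imp. auto. }
apply C3_eq. intros c Hc. rewrite !coord_dirD; auto.
apply Derive_ext_loc. revert HL. apply filter_imp.
intros x Hx. now rewrite Hx.
Qed.
Lemma class_C_dirD k (U : E -> Prop) (f : E -> C3) X :
  open U -> class_C (S k) U f -> class_C k U (fun p => dirD f p X).
Proof.
intros HU Hf. apply class_C_coords; auto. intros c Hc.
apply (classR_ext k U (fun p => dirR (fun q => c (f q)) p X)); auto.
- intros q _. symmetry. now apply coord_dirD.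
- apply classR_dir; auto. now apply class_C_coord.
Qed.

Lemma dirD_ext (f h : E -> C3) p X :
  (forall q, f q = h q) -> dirD f p X = dirD h p X.
Proof.
intros H. apply (dirD_local (fun _ => True)); [apply open_all | exact I | ].
intros q _. apply H.
Qed.
End Comps.

Lemma g_coords (x y : C3) :
  g x y = re1 x * re1 y + im1 x * im1 y + (re2 x * re2 y + im2 x * im2 y) +
    (re3 x * re3 y + im3 x * im3 y).
Proof.
destruct x as [[[? ?] [? ?]] [? ?]]. destruct y as [[[? ?] [? ?]] [? ?]].
unfold g, re1, im1, re2, im2, re3, im3, co1, co2, co3. simpl. ring.
Qed.

(** The flat Laplacian of a map from R^2 to C^3. *)
Definition lapD (f : R2 -> C3) (p : R2) : C3 :=
  plus (dirD (fun q => dirD f q e_s) p e_s) (dirD (fun q => dirD f q e_t) p e_t).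

Lemma lapD_ext (f h : R2 -> C3) p :
  (forall q, f q = h q) -> lapD f p = lapD h p.
Proof.
intros H. unfold lapD. f_equal; apply dirD_ext; intros q; now apply dirD_ext.
Qed.

(** The density |f_s|^2 + |f_t|^2. *)
Definition dirichlet (f : R2 -> C3) (p : R2) : R :=
  g (dirD f p e_s) (dirD f p e_s) + g (dirD f p e_t) (dirD f p e_t).

Lemma first_variation_C3 (delta rho : R) (G : R3 -> C3) :
  0 < delta -> 0 < rho ->
  class_C 2 (fun x : R3 => Rabs (fst x) < delta) G ->
  (forall x s t, Rabs x < delta -> rho < Rabs s \/ rho < Rabs t ->
     G (x, mkR2 s t) = G (0, mkR2 s t)) ->
  first_variation delta rho
    (fun x => dirichlet (fun q => G (fst x, q)) (snd x))
    (fun p => - 2 * g (lapD (fun q => G (0, q)) p) (dirD G (0, p) e_eps)).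
Proof.
intros Hd Hr HG Hs.
assert (H : forall c, In c coords -> first_variation delta rho
    (fun x => dirR (fun q => c (G (fst x, q))) (snd x) e_s ^ 2 +
              dirR (fun q => c (G (fst x, q))) (snd x) e_t ^ 2)
    (fun p => - 2 * (lapR (fun q => c (G (0, q))) p *
                     dirR (fun x => c (G x)) (0, p) e_eps))).
{ intros c Hc. apply (first_variation_dirichlet delta rho (fun x => c (G x))); auto.
  - now apply class_C_coord.
  - intros x s t Hx Hst. f_equal. now apply Hs. }
rewrite forall_coords in H. destruct H as ((H1 & H2) & (H3 & H4) & H5 & H6).
assert (HH := first_variation_plus _ _ _ _ _ _ Hd Hr
  (first_variation_plus _ _ _ _ _ _ Hd Hr
    (first_variation_plus _ _ _ _ _ _ Hd Hr H1 H2)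
    (first_variation_plus _ _ _ _ _ _ Hd Hr H3 H4))
  (first_variation_plus _ _ _ _ _ _ Hd Hr H5 H6)).
revert HH. apply first_variation_ext; auto.
- intros x p _. unfold dirichlet. rewrite !g_coords.
  match goal with |- ?l = _ => set (L := l) end.
  change (L =
   (let f := fun (c : C3 -> R) X => dirR (fun q => c (G (x, q))) p X in
    f re1 e_s * f re1 e_s + f im1 e_s * f im1 e_s +
    (f re2 e_s * f re2 e_s + f im2 e_s * f im2 e_s) +
    (f re3 e_s * f re3 e_s + f im3 e_s * f im3 e_s) +
    (f re1 e_t * f re1 e_t + f im1 e_t * f im1 e_t +
    (f re2 e_t * f re2 e_t + f im2 e_t * f im2 e_t) +
    (f re3 e_t * f re3 e_t + f im3 e_t * f im3 e_t)))).
  unfold L. simpl. ring.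
- intros p. rewrite g_coords.
  match goal with |- ?l = _ => set (L := l) end.
  change (L = - 2 *
   (let f := fun (c : C3 -> R) => lapR (fun q => c (G (0, q))) p in
    let h := fun (c : C3 -> R) => dirR (fun x => c (G x)) (0, p) e_eps in
    f re1 * h re1 + f im1 * h im1 + (f re2 * h re2 + f im2 * h im2) +
    (f re3 * h re3 + f im3 * h im3))).
  unfold L. simpl. ring.
Qed.

(** * Complex-valued functions *)

Section ClassComplex.
Context {E : NormedModule R_AbsRing}.

(** Class C^k for complex-valued functions, by real and imaginary parts. *)
Definition classCx (k : nat) (U : E -> Prop) (f : E -> C) : Prop :=
  classR k U (fun p => Re (f p)) /\ classR k U (fun p => Im (f p)).

Lemma classCx_const k U c : classCx k U (fun _ => c).
Proof. split; apply classR_const. Qed.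

Lemma classCx_conj k U f : classCx k U f -> classCx k U (fun p => Cconj (f p)).
Proof. intros [H1 H2]. split; [exact H1 | now apply classR_opp]. Qed.

Lemma classCx_mult k U f h :
  classCx k U f -> classCx k U h -> classCx k U (fun p => (f p * h p)%C).
Proof.
intros [H1 H2] [H3 H4]. split.
- apply (classR_plus k U (fun p => Re (f p) * Re (h p))
    (fun p => - (Im (f p) * Im (h p)))).
  + apply (classR_mult k U _ _ H1 H3).
  + apply (classR_opp k U _ (classR_mult k U _ _ H2 H4)).
- apply (classR_plus k U (fun p => Re (f p) * Im (h p))
    (fun p => Im (f p) * Re (h p))).
  + apply (classR_mult k U _ _ H1 H4).
  + apply (classR_mult k U _ _ H2 H3).
Qed.

Lemma classCx_ext k U f h : open U -> (forall p, U p -> f p = h p) ->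
  classCx k U f -> classCx k U h.
Proof.
intros HU He [H1 H2].
split.
- apply (classR_ext k U (fun p => Re (f p))); auto. intros q Hq. now rewrite He.
- apply (classR_ext k U (fun p => Im (f p))); auto. intros q Hq. now rewrite He.
Qed.

Lemma class_C_co k (U : E -> Prop) (f : E -> C3) :
  open U ->
  class_C k U f <-> classCx k U (fun p => co1 (f p)) /\
    classCx k U (fun p => co2 (f p)) /\ classCx k U (fun p => co3 (f p)).
Proof.
intros HU.
transitivity (forall c, In c coords -> classR k U (fun p => c (f p))).
- split; intros H.
  + intros c Hc. now apply class_C_coord.
  + now apply class_C_coords.
- apply (forall_coords (fun c => classR k U (fun p => c (f p)))).
Qed.
End ClassComplex.

Lemma is_deriveC_eq f x l l' : is_deriveC f x l -> l = l' -> is_deriveC f x l'.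
Proof. now intros H <-. Qed.

Lemma is_deriveC_const (c : C) x : is_deriveC (fun _ => c) x (RtoC 0).
Proof. apply (is_derive_const (V := C_R_NormedModule)). Qed.

Lemma is_deriveC_conj f x l :
  is_deriveC f x l -> is_deriveC (fun y => Cconj (f y)) x (Cconj l).
Proof.
rewrite !is_deriveC_parts. intros [H1 H2]. split; [exact H1 | ].
apply (is_derive_opp (V := R_NormedModule) (fun y => Im (f y)) x (Im l) H2).
Qed.

Lemma is_deriveC_mult f h x l m :
  is_deriveC f x l -> is_deriveC h x m ->
  is_deriveC (fun y => (f y * h y)%C) x (l * h x + f x * m)%C.
Proof.
rewrite !is_deriveC_parts. intros [H1 H2] [H3 H4]. split.
- refine (eq_rect _ (fun l => is_derive _ x l)
   (is_derive_minus (V := R_NormedModule) _ _ _ _ _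
   (Derive.is_derive_mult _ _ _ _ _ H1 H3)
   (Derive.is_derive_mult _ _ _ _ _ H2 H4)) _ _).
  unfold minus, plus, opp. simpl. unfold Re, Im. ring.
- refine (eq_rect _ (fun l => is_derive _ x l)
   (is_derive_plus (V := R_NormedModule) _ _ _ _ _
   (Derive.is_derive_mult _ _ _ _ _ H1 H4)
   (Derive.is_derive_mult _ _ _ _ _ H2 H3)) _ _).
  unfold minus, plus, opp. simpl. unfold Re, Im. ring.
Qed.

(** * Hermitian products and rank-one matrices *)

(** The Hermitian product, linear in the first argument; its real part is [g]. *)
Definition herm (x y : C3) : C :=
  (co1 x * Cconj (co1 y) + co2 x * Cconj (co2 y) + co3 x * Cconj (co3 y))%C.

(** One column of the matrix x y^H: its entries are x_j times the conjugate of
    [co y], where [co] is one of the coordinates [co1], [co2], [co3]. *)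
Definition outer (co : C3 -> C) (x y : C3) : C3 := cscal (Cconj (co y)) x.

(** The real Hilbert-Schmidt product of two matrices given by their columns. *)
Definition hs (A B : (C3 -> C) -> C3) : R :=
  g (A co1) (B co1) + g (A co2) (B co2) + g (A co3) (B co3).

Ltac c3 x := destruct x as [[[? ?] [? ?]] [? ?]].

Lemma g_plus_l x y z : g (plus x y) z = g x z + g y z.
Proof.
rewrite !g_coords.
c3 x; c3 y; c3 z. unfold re1, im1, re2, im2, re3, im3, co1, co2, co3.
unfold plus. simpl. unfold plus. simpl. ring.
Qed.

Lemma g_sym x y : g x y = g y x.
Proof. rewrite !g_coords. ring. Qed.

Lemma g_plus_r x y z : g z (plus x y) = g z x + g z y.
Proof. rewrite g_sym, g_plus_l, (g_sym x), (g_sym y). ring. Qed.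

Lemma g_scal_l r x y : g (scal r x) y = r * g x y.
Proof.
rewrite !g_coords.
c3 x; c3 y. unfold re1, im1, re2, im2, re3, im3, co1, co2, co3.
unfold scal. simpl. unfold scal. simpl. unfold mult. simpl. ring.
Qed.

Lemma g_scal_r r x y : g x (scal r y) = r * g x y.
Proof. rewrite g_sym, g_scal_l, g_sym. reflexivity. Qed.

Lemma herm_sym x y : herm y x = Cconj (herm x y).
Proof.
c3 x; c3 y. unfold herm, co1, co2, co3, Cconj, Cmult, Cplus. simpl.
f_equal; ring.
Qed.

Lemma hs_outer a b c d :
  hs (fun co => outer co a b) (fun co => outer co c d) =
  Re (herm a c * Cconj (herm b d))%C.
Proof.
c3 a; c3 b; c3 c; c3 d.
unfold hs, outer, herm, g, cscal, mkC3, co1, co2, co3, Cconj, Cmult, Cplus, Re.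
simpl. ring.
Qed.

Lemma herm_cscal_r c x y : herm x (cscal c y) = (Cconj c * herm x y)%C.
Proof.
c3 x; c3 y. destruct c. unfold herm, cscal, mkC3, co1, co2, co3, Cconj, Cmult, Cplus.
simpl. f_equal; ring.
Qed.

Lemma herm_self x : herm x x = RtoC (g x x).
Proof.
c3 x. unfold herm, g, co1, co2, co3, Cconj, Cmult, Cplus, RtoC, Re. simpl.
f_equal; ring.
Qed.

Lemma forall_co (P : (C3 -> C) -> Prop) :
  (forall co, In co [co1; co2; co3] -> P co) <-> P co1 /\ P co2 /\ P co3.
Proof.
split.
- intros H. repeat split; apply H; simpl; tauto.
- intros (H1 & H2 & H3) c Hc. simpl in Hc. decompose [or] Hc; subst; easy.
Qed.

Lemma outer_plus_l co x y z :
  outer co (plus x y) z = plus (outer co x z) (outer co y z).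
Proof.
unfold outer. destruct (Cconj (co z)). c3 x; c3 y. apply C3_eq, forall_coords.
unfold cscal, mkC3, re1, im1, re2, im2, re3, im3, co1, co2, co3, Cmult, plus.
simpl. unfold plus. simpl. repeat split; ring.
Qed.

Lemma outer_plus_r co x y z : In co [co1; co2; co3] ->
  outer co z (plus x y) = plus (outer co z x) (outer co z y).
Proof.
intros Hco.
assert (H : co (plus x y) = (co x + co y)%C).
{ revert co Hco. apply (forall_co (fun co => co (plus x y) = (co x + co y)%C)).
  now c3 x; c3 y. }
unfold outer. rewrite H. destruct (co x), (co y). c3 z.
apply C3_eq, forall_coords.
unfold cscal, mkC3, re1, im1, re2, im2, re3, im3, co1, co2, co3, Cmult, plus.
simpl. unfold plus. simpl. repeat split; ring.
Qed.

Lemma outer_scal_l co r x z : outer co (scal r x) z = scal r (outer co x z).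
Proof.
unfold outer. destruct (Cconj (co z)). c3 x. apply C3_eq, forall_coords.
unfold cscal, mkC3, re1, im1, re2, im2, re3, im3, co1, co2, co3, Cmult, scal.
simpl. unfold scal. simpl. unfold mult. simpl. repeat split; ring.
Qed.

Lemma Cmult_RtoC_l (r : R) (z : C) : (RtoC r * z)%C = (r * fst z, r * snd z).
Proof. destruct z. unfold Cmult, RtoC. simpl. f_equal; ring. Qed.

Lemma outer_scal_r co r x z : In co [co1; co2; co3] ->
  outer co z (scal r x) = scal r (outer co z x).
Proof.
intros Hco.
assert (H : co (scal r x) = (RtoC r * co x)%C).
{ revert co Hco. apply (forall_co (fun co => co (scal r x) = (RtoC r * co x)%C)).
  repeat split; rewrite Cmult_RtoC_l; reflexivity. }
unfold outer. rewrite H. destruct (co x). c3 z.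
apply C3_eq, forall_coords.
unfold cscal, mkC3, re1, im1, re2, im2, re3, im3, co1, co2, co3, Cmult, scal.
simpl. unfold scal. simpl. unfold mult. simpl. repeat split; ring.
Qed.

Lemma herm_plus_l x y z : herm (plus x y) z = (herm x z + herm y z)%C.
Proof.
c3 x; c3 y; c3 z. unfold herm, co1, co2, co3, Cconj, Cmult, Cplus, plus. simpl.
unfold plus. simpl. f_equal; ring.
Qed.

Lemma herm_scal_l r x z : herm (scal r x) z = (RtoC r * herm x z)%C.
Proof.
c3 x; c3 z. unfold herm, co1, co2, co3, Cconj, Cmult, Cplus, RtoC, scal. simpl.
unfold scal. simpl. unfold mult. simpl. f_equal; ring.
Qed.

Lemma g_hor x a b : g x x = 1 ->
  g (hor x a) (hor x b) = g a b - Im (herm a x) * Im (herm b x).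
Proof.
intros Hx. unfold hor, minus.
assert (Hi : forall a, g a (cscal Ci x) = Im (herm a x)).
{ intros u. c3 u; c3 x. unfold g, herm, cscal, mkC3, co1, co2, co3, Cconj,
    Cmult, Cplus, Ci, Re, Im. simpl. ring. }
assert (Hii : g (cscal Ci x) (cscal Ci x) = 1).
{ rewrite <- Hx. clear. c3 x. unfold g, herm, cscal, mkC3, co1, co2, co3, Cconj,
    Cmult, Cplus, Ci, Re, Im. simpl. ring. }
assert (Ho : forall (u v : C3), g (opp u) v = - g u v).
{ intros u v. rewrite !g_coords. c3 u; c3 v.
  unfold re1, im1, re2, im2, re3, im3, co1, co2, co3.
  unfold opp. simpl. unfold opp. simpl. ring. }
rewrite !g_plus_l, !Ho, !g_scal_l.
rewrite (g_sym a (plus _ _)), (g_sym (cscal Ci x) (plus _ _)).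
rewrite !g_plus_l, !Ho, !g_scal_l, Hii, (g_sym (cscal Ci x) a), (g_sym b a), !Hi.
ring.
Qed.

Lemma hs_plus_l (A B D : (C3 -> C) -> C3) :
  hs (fun co => plus (A co) (B co)) D = hs A D + hs B D.
Proof. unfold hs. rewrite !g_plus_l. ring. Qed.

Lemma hs_plus_r (A B D : (C3 -> C) -> C3) :
  hs D (fun co => plus (A co) (B co)) = hs D A + hs D B.
Proof. unfold hs. rewrite !g_plus_r. ring. Qed.

Lemma hs_ext (A A' B : (C3 -> C) -> C3) :
  (forall co, In co [co1; co2; co3] -> A co = A' co) -> hs A B = hs A' B.
Proof. intros H. unfold hs. now rewrite !H by (simpl; tauto). Qed.

Lemma hs_scal_l r (A B : (C3 -> C) -> C3) :
  hs (fun co => scal r (A co)) B = r * hs A B.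
Proof. unfold hs. rewrite !g_scal_l. ring. Qed.

(** Horizontal parts of tangent vectors at x and the Hilbert-Schmidt product of the
    corresponding derivatives of x x^H. *)
Lemma g_hor_outer x a b : g a x = 0 -> g b x = 0 -> g x x = 1 ->
  g (hor x a) (hor x b) =
  1 / 2 * hs (fun co => plus (outer co a x) (outer co x a))
             (fun co => plus (outer co b x) (outer co x b)).
Proof.
intros Ha Hb Hx.
rewrite g_hor by exact Hx.
rewrite hs_plus_l, !hs_plus_r, !hs_outer, (herm_self x), Hx.
rewrite (herm_sym b x).
change (g a x) with (Re (herm a x)) in Ha.
change (g b x) with (Re (herm b x)) in Hb.
change (g a b) with (Re (herm a b)).
destruct (herm a x) as [a1 a2]. destruct (herm b x) as [b1 b2].
destruct (herm a b) as [u1 u2].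
unfold Re, Im, Cmult, Cconj, RtoC in *. simpl in *. subst. field.
Qed.

(** * Projectors and the Fubini-Study metric *)

Lemma is_derive3_outer (co : C3 -> C) (f h : R -> C3) x l m :
  In co [co1; co2; co3] ->
  is_derive3 f x l -> is_derive3 h x m ->
  is_derive3 (fun y => outer co (f y) (h y)) x
    (plus (outer co l (h x)) (outer co (f x) m)).
Proof.
intros Hco Hf Hh.
assert (Hc : is_deriveC (fun y => Cconj (co (h y))) x (Cconj (co m))).
{ apply is_deriveC_conj.
  rewrite is_derive3_parts in Hh. destruct Hh as (H1 & H2 & H3).
  revert co Hco.
  now apply (forall_co (fun co => is_deriveC (fun y => co (h y)) x (co m))). }
rewrite is_derive3_parts in Hf |- *. destruct Hf as (H1 & H2 & H3).
assert (K : forall cc : C3 -> C, is_deriveC (fun y => cc (f y)) x (cc l) ->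
  is_deriveC (fun y => (Cconj (co (h y)) * cc (f y))%C) x
    (Cconj (co (h x)) * cc l + Cconj (co m) * cc (f x))%C).
{ intros cc Hcc. apply (is_deriveC_eq _ _ _ _ (is_deriveC_mult _ _ _ _ _ Hc Hcc)).
  ring. }
split; [exact (K co1 H1) | split; [exact (K co2 H2) | exact (K co3 H3)]].
Qed.

Lemma is_derive_g (f h : R -> C3) x l m :
  is_derive3 f x l -> is_derive3 h x m ->
  is_derive (fun y => g (f y) (h y)) x (g l (h x) + g (f x) m).
Proof.
intros Hf Hh. rewrite <- is_derive3_coords in Hf, Hh.
assert (K : forall c, In c coords -> is_derive (fun y => c (f y) * c (h y)) x
  (c l * c (h x) + c (f x) * c m)).
{ intros c Hc. apply Derive.is_derive_mult; auto. }
rewrite forall_coords in K. destruct K as ((K1 & K2) & (K3 & K4) & K5 & K6).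
assert (P := is_derive_plus (V := R_NormedModule) _ _ _ _ _
  (is_derive_plus (V := R_NormedModule) _ _ _ _ _
    (is_derive_plus (V := R_NormedModule) _ _ _ _ _ K1 K2)
    (is_derive_plus (V := R_NormedModule) _ _ _ _ _ K3 K4))
  (is_derive_plus (V := R_NormedModule) _ _ _ _ _ K5 K6)).
rewrite !g_coords.
apply (is_derive_ext (fun y => re1 (f y) * re1 (h y) + im1 (f y) * im1 (h y) +
  (re2 (f y) * re2 (h y) + im2 (f y) * im2 (h y)) +
  (re3 (f y) * re3 (h y) + im3 (f y) * im3 (h y)))).
{ intros y. now rewrite g_coords. }
refine (eq_rect _ (fun l => is_derive _ x l) P _ _).
unfold plus. simpl. ring.
Qed.

Section Lifts.
Context {E : NormedModule R_AbsRing}.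

(** The derivative of a map into the sphere is tangent to the sphere. *)
Lemma sphere_dirD (W : E -> Prop) (f : E -> C3) k p X :
  open W -> W p -> class_C (S k) W f -> (forall q, W q -> on_sphere (f q)) ->
  g (dirD f p X) (f p) = 0.
Proof.
intros HW Hp Hf Hs.
assert (Hd := class_C_derive k W f p X Hf Hp).
assert (Hg := is_derive_g _ _ _ _ _ Hd Hd).
assert (Hc : is_derive (fun h : R => g (f (plus p (scal h X)))
   (f (plus p (scal h X)))) 0 0).
{ apply (is_derive_ext_loc (fun _ => 1)).
  - generalize (open_line W p X HW Hp). apply filter_imp. intros h Hh.
    symmetry. now apply Hs.
  - apply (is_derive_const (V := R_NormedModule)). }
assert (H0 := eq_trans (eq_sym (is_derive_unique _ _ _ Hc))
  (is_derive_unique _ _ _ Hg)).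
cbv beta in H0. rewrite line_0, (g_sym (f p)) in H0. lra.
Qed.

Lemma class_C_outer co k (W : E -> Prop) (f : E -> C3) :
  In co [co1; co2; co3] -> open W -> class_C k W f ->
  class_C k W (fun p => outer co (f p) (f p)).
Proof.
intros Hco HW. rewrite !class_C_co by assumption. intros H.
assert (Hc : classCx k W (fun p => Cconj (co (f p)))).
{ apply classCx_conj. revert co Hco.
  now apply (forall_co (fun co => classCx k W (fun p => co (f p)))). }
destruct H as (H1 & H2 & H3).
split; [ | split].
- apply (classCx_mult k W _ _ Hc H1).
- apply (classCx_mult k W _ _ Hc H2).
- apply (classCx_mult k W _ _ Hc H3).
Qed.

Lemma dirD_outer co (W : E -> Prop) (f : E -> C3) p X :
  In co [co1; co2; co3] -> W p -> class_C 1 W f ->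
  dirD (fun q => outer co (f q) (f q)) p X =
  plus (outer co (dirD f p X) (f p)) (outer co (f p) (dirD f p X)).
Proof.
intros Hco Hp Hf. apply is_derive3_dirD.
assert (Hd := class_C_derive 0 W f p X Hf Hp).
generalize (is_derive3_outer co _ _ _ _ _ Hco Hd Hd). now rewrite line_0.
Qed.
End Lifts.

Lemma hopf_refl (x : C3) : hopf x x.
Proof.
exists (RtoC 1). c3 x. unfold cscal, mkC3, co1, co2, co3, Cmult, RtoC. simpl.
repeat f_equal; ring.
Qed.

(** Two unit vectors on the same complex line differ by a phase. *)
Lemma hopf_eq_cscal (x y : C3) :
  on_sphere x -> on_sphere y -> hopf x = hopf y ->
  exists c, (c * Cconj c)%C = RtoC 1 /\ x = cscal c y.
Proof.
intros Hx Hy Hxy.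
assert (Hin : hopf y x) by (rewrite <- Hxy; apply hopf_refl).
destruct Hin as [c Hc]. exists c. split; [ | exact Hc].
assert (Hn : herm x x = RtoC 1) by (rewrite herm_self; now f_equal).
rewrite Hc, herm_cscal_r, herm_sym, herm_cscal_r, herm_self, Hy in Hn.
rewrite <- Hn. destruct c. unfold Cmult, Cconj, RtoC. simpl. f_equal; ring.
Qed.

Lemma outer_cscal co c x : In co [co1; co2; co3] ->
  (c * Cconj c)%C = RtoC 1 -> outer co (cscal c x) (cscal c x) = outer co x x.
Proof.
intros Hco Hc.
assert (K : forall a b, (Cconj (c * a) * (c * b) = Cconj a * b)%C).
{ intros a b. transitivity ((c * Cconj c) * (Cconj a * b))%C.
  - destruct a, b, c. unfold Cmult, Cconj. simpl. f_equal; ring.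
  - rewrite Hc. ring. }
revert co Hco.
apply (forall_co (fun co => outer co (cscal c x) (cscal c x) = outer co x x)).
unfold outer, cscal, mkC3, co1, co2, co3. simpl.
repeat split; now rewrite !K.
Qed.

(** A unit vector on the line [L], chosen arbitrarily; a meaningless vector if [L] is
    not a line. *)
Definition unit_rep (L : C3 -> Prop) : C3 :=
  epsilon (inhabits (zero : C3)) (fun x => on_sphere x /\ L = hopf x).

(** A column of the orthogonal projector onto the line [L]; by [proj_hopf] it can be
    computed from any unit vector of the line. *)
Definition proj (co : C3 -> C) (L : C3 -> Prop) : C3 :=
  outer co (unit_rep L) (unit_rep L).

Lemma proj_hopf co x : In co [co1; co2; co3] -> on_sphere x ->
  proj co (hopf x) = outer co x x.
Proof.
intros Hco Hx.
destruct (epsilon_spec (inhabits (zero : C3))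
  (fun y => on_sphere y /\ hopf x = hopf y) (ex_intro _ x (conj Hx eq_refl)))
  as [H1 H2].
fold (unit_rep (hopf x)) in H1, H2.
destruct (hopf_eq_cscal _ _ H1 Hx (eq_sym H2)) as (c & Hc & He).
unfold proj. rewrite He. now apply outer_cscal.
Qed.

Lemma dirD_proj {E : NormedModule R_AbsRing} co (u : E -> (C3 -> Prop)) p f X :
  In co [co1; co2; co3] -> local_lift u p f ->
  dirD (fun q => proj co (u q)) p X =
  plus (outer co (dirD f p X) (f p)) (outer co (f p) (dirD f p X)).
Proof.
intros Hco (W & HW & Hp & Hf & Hu).
rewrite <- (dirD_outer co W) by auto.
apply (dirD_local W); auto. intros q Hq. destruct (Hu q Hq) as [Hs ->].
now apply proj_hopf.
Qed.

(** The right-hand side does not mention the lift: the inner product of horizontal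
    parts is the same for all local lifts. *)
Lemma g_hor_proj {E : NormedModule R_AbsRing} (u : E -> (C3 -> Prop)) p f X Y :
  local_lift u p f ->
  g (hor (f p) (dirD f p X)) (hor (f p) (dirD f p Y)) =
  1 / 2 * hs (fun co => dirD (fun q => proj co (u q)) p X)
             (fun co => dirD (fun q => proj co (u q)) p Y).
Proof.
intros Hlift. assert (H := Hlift). destruct H as (W & HW & Hp & Hf & Hu).
rewrite g_hor_outer.
- unfold hs. now rewrite !(dirD_proj _ u p f) by (auto; simpl; tauto).
- apply (sphere_dirD W f 0); auto. intros q Hq. now apply Hu.
- apply (sphere_dirD W f 0); auto. intros q Hq. now apply Hu.
- now apply Hu.
Qed.

(** The pullback of the Fubini-Study metric may be computed from any one local
    lift. *)
Lemma pullback_CP2 {E : NormedModule R_AbsRing} (u : E -> (C3 -> Prop)) p f X Y :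
  local_lift u p f ->
  pullback CP2 u p X Y = g (hor (f p) (dirD f p X)) (hor (f p) (dirD f p Y)).
Proof.
intros Hf. simpl.
destruct (iota_correct (V := R_CompleteNormedModule)
  (fun c : R => exists f, local_lift u p f /\
      c = g (hor (f p) (dirD f p X)) (hor (f p) (dirD f p Y)))) as (h & Hh & He).
- eexists. split.
  + exists f. split; [exact Hf | reflexivity].
  + intros c (h & Hh & ->). now rewrite !(g_hor_proj u).
- rewrite (g_hor_proj u p f), <- (g_hor_proj u p h) by assumption. exact He.
Qed.

Section SliceLift.
Context {E : NormedModule R_AbsRing}.
Let RE : NormedModule R_AbsRing := prod_NormedModule R_AbsRing R_NormedModule E.

(** A lift of a variation restricts to a lift of each map of the variation. *)
Lemma local_lift_slice (F : R -> E -> (C3 -> Prop)) (e : R) (p : E) (f : RE -> C3) :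
  local_lift (fun x : RE => F (fst x) (snd x)) (e, p) f ->
  local_lift (F e) p (fun q => f (e, q)).
Proof.
intros (W & HW & Hp & Hf & Hu).
exists (fun q => W (e, q)).
assert (HO : open (fun q => W (e, q))).
{ apply (open_comp (fun q : E => (e, q) : RE) W); [ | exact HW].
  intros q _. apply (continuous_pair (fun _ => e) (fun q : E => q)).
  - apply continuous_const.
  - apply continuous_id. }
split; [exact HO | split; [exact Hp | split]].
- intros k. apply class_C_coords; [exact HO | ]. intros c Hc.
  apply (classR_slice e k W (fun x => c (f x))). now apply class_C_coord.
- intros q Hq. now apply (Hu (e, q)).
Qed.
End SliceLift.

Lemma class_C_glue {E : NormedModule R_AbsRing} k (U : E -> Prop) (f : E -> C3) :
  open U ->
  (forall p, U p -> exists (W : E -> Prop) (h : E -> C3),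
     open W /\ W p /\ (forall q, W q -> f q = h q) /\ class_C k W h) ->
  class_C k U f.
Proof.
intros HU H. apply class_C_coords; auto. intros c Hc.
apply classR_glue. intros p Hp. destruct (H p Hp) as (W & h & HW & HWp & He & Hh).
exists W, (fun q => c (h q)). split; [exact HW | split; [exact HWp | split]].
- intros q Hq. now rewrite He.
- now apply class_C_coord.
Qed.

Lemma class_C_proj co k {E : NormedModule R_AbsRing} (U : E -> Prop)
    (u : E -> (C3 -> Prop)) :
  In co [co1; co2; co3] -> open U ->
  (forall p, U p -> exists f, local_lift u p f) ->
  class_C k U (fun q => proj co (u q)).
Proof.
intros Hco HU H. apply class_C_glue; auto. intros p Hp.
destruct (H p Hp) as (f & W & HW & HWp & Hf & Hu).
exists W, (fun q => outer co (f q) (f q)).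
split; [exact HW | split; [exact HWp | split]].
- intros q Hq. destruct (Hu q Hq) as [Hs ->]. now apply proj_hopf.
- now apply class_C_outer.
Qed.

(** * Criteria for harmonicity *)

(** A map into the sphere is harmonic if its Laplacian is normal to the sphere. *)
Lemma harmonic_S5 (u : R2 -> C3) :
  smooth_map S5 (fun _ => True) u ->
  (forall p (X : C3), g (u p) X = 0 -> g (lapD u p) X = 0) ->
  harmonic S5 u.
Proof.
intros Hu Hlap. split; [exact Hu | ].
intros delta rho F Hd Hr [HF1 HF2] H0 Hs. simpl in F.
assert (H00 : Rabs 0 < delta) by now rewrite Rabs_R0.
set (G := fun x : R3 => F (fst x) (snd x)).
assert (HV := first_variation_C3 delta rho G Hd Hr (HF1 2%nat)).
assert (HE : first_variation delta rho
   (fun x => energy_density S5 (F (fst x)) (snd x)) (fun _ => 0)).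
{ refine (first_variation_ext _ _ _ _ _ _ Hd _ _ (HV _)).
  - intros x p _. reflexivity.
  - intros p.
    assert (EG : lapD (fun q => G (0, q)) p = lapD u p) by (apply lapD_ext, H0).
    rewrite EG, Hlap; [ring | ].
    rewrite <- (H0 p), g_sym. change (F 0 p) with (G (0, p)).
    apply (sphere_dirD (fun x : R3 => Rabs (fst x) < delta) G 0); auto.
    apply open_strip.
  - intros x s t Hx Hst. unfold G. simpl.
    rewrite (Hs x s t Hx Hst), H0. reflexivity. }
destruct HE as (_ & _ & HE). rewrite dint_zero in HE. exact HE.
Qed.

(** A map into CP^2 is harmonic if the Laplacian of the associated projector is
    orthogonal to the tangent vectors X x^H + x X^H of the set of projectors. *)
Lemma harmonic_CP2 (u : R2 -> (C3 -> Prop)) :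
  smooth_map CP2 (fun _ => True) u ->
  (forall p x X, on_sphere x -> u p = hopf x -> g x X = 0 ->
     hs (fun co => lapD (fun q => proj co (u q)) p)
        (fun co => plus (outer co X x) (outer co x X)) = 0) ->
  harmonic CP2 u.
Proof.
intros Hu Hlap. split; [exact Hu | ].
intros delta rho F Hd Hr HF H0 Hs. simpl in F.
assert (H00 : Rabs 0 < delta) by now rewrite Rabs_R0.
set (U := fun x : R3 => Rabs (fst x) < delta).
assert (HU : open U) by apply open_strip.
set (G := fun co (x : R3) => proj co (F (fst x) (snd x))).
assert (HV : forall co, In co [co1; co2; co3] -> first_variation delta rho
    (fun x => dirichlet (fun q => G co (fst x, q)) (snd x))
    (fun p => - 2 * g (lapD (fun q => proj co (u q)) p) (dirD (G co) (0, p) e_eps))).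
{ intros co Hco.
  refine (first_variation_ext _ _ _ _ _ _ Hd _ _
    (first_variation_C3 delta rho (G co) Hd Hr _ _)).
  - intros x p _. reflexivity.
  - intros p. do 2 f_equal. apply lapD_ext. intros q. unfold G. simpl.
    now rewrite H0.
  - apply (class_C_proj co 2 U (fun x : R3 => F (fst x) (snd x))); auto.
  - intros x s t Hx Hst. unfold G. simpl. now rewrite (Hs x s t Hx Hst), H0. }
rewrite forall_co in HV. destruct HV as (V1 & V2 & V3).
assert (HE : first_variation delta rho
   (fun x => energy_density CP2 (F (fst x)) (snd x)) (fun _ => 0)).
{ refine (first_variation_ext _ _ _ _ _ _ Hd _ _
    (first_variation_scal _ _ (1 / 2) _ _ Hd Hr
    (first_variation_plus _ _ _ _ _ _ Hd Hr
      (first_variation_plus _ _ _ _ _ _ Hd Hr V1 V2) V3))).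
  - intros x p Hx. destruct (HF (x, p) Hx) as [f Hf].
    unfold energy_density.
    assert (HL := local_lift_slice F x p f Hf).
    rewrite !(pullback_CP2 (F x) p _ _ _ HL), !(g_hor_proj (F x) p _ _ _ HL).
    assert (Haux : forall a1 b1 a2 b2 a3 b3, 1 / 2 * (a1 + b1 + (a2 + b2) + (a3 + b3))
      = 1 / 2 * (a1 + a2 + a3) + 1 / 2 * (b1 + b2 + b3)) by (intros; ring).
    exact (Haux _ _ _ _ _ _).
  - intros p. destruct (HF (0, p) H00) as [f Hf].
    unfold G.
    rewrite !(dirD_proj _ _ _ f) by (auto; simpl; tauto).
    destruct Hf as (W & HW & HWp & Hf & HFf).
    destruct (HFf _ HWp) as [Hsf Hff].
    assert (Hz := Hlap p (f (0, p)) (dirD f (0, p) e_eps) Hsf).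
    simpl in Hff. rewrite H0 in Hff. specialize (Hz Hff).
    rewrite g_sym in Hz.
    rewrite (sphere_dirD W f 0 (0, p) e_eps) in Hz; auto.
    2: { intros q Hq. now apply HFf. }
    specialize (Hz eq_refl). unfold hs in Hz.
    match goal with |- 1 / 2 * (- 2 * ?a + - 2 * ?b + - 2 * ?c) = 0 =>
      replace (1 / 2 * (- 2 * a + - 2 * b + - 2 * c)) with (- (a + b + c)) by field end.
    apply Ropp_eq_0_compat. exact Hz. }
destruct HE as (_ & _ & HE). rewrite dint_zero in HE. exact HE.
Qed.

(** * Legendrian maps with radial Laplacian *)

Lemma is_derive3_plus (f h : R -> C3) x l m :
  is_derive3 f x l -> is_derive3 h x m ->
  is_derive3 (fun y => plus (f y) (h y)) x (plus l m).
Proof. apply (is_derive_plus (V := C3)). Qed.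

Lemma dirD2_outer co (f : R2 -> C3) p X :
  In co [co1; co2; co3] -> class_C 2 (fun _ => True) f ->
  dirD (fun q => dirD (fun q => outer co (f q) (f q)) q X) p X =
  plus (plus (outer co (dirD (fun q => dirD f q X) p X) (f p))
          (outer co (dirD f p X) (dirD f p X)))
       (plus (outer co (dirD f p X) (dirD f p X))
          (outer co (f p) (dirD (fun q => dirD f q X) p X))).
Proof.
intros Hco Hf.
assert (H1 : class_C 1 (fun _ : R2 => True) f).
{ apply class_C_coords; [apply open_all | ]. intros c Hc.
  now apply classR_pred, class_C_coord. }
assert (H2 : class_C 1 (fun _ : R2 => True) (fun q => dirD f q X))
  by (apply class_C_dirD; [apply open_all | exact Hf]).
assert (D1 := class_C_derive 0 (fun _ => True) f p X H1 I).
assert (D2 := class_C_derive 0 (fun _ => True) _ p X H2 I).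
transitivity (dirD (fun q => plus (outer co (dirD f q X) (f q))
  (outer co (f q) (dirD f q X))) p X).
- apply (dirD_local (fun _ => True)); [apply open_all | exact I | ].
  intros q _. now apply (dirD_outer co (fun _ => True)).
- apply is_derive3_dirD.
  generalize (is_derive3_plus _ _ _ _ _
    (is_derive3_outer co _ _ _ _ _ Hco D2 D1)
    (is_derive3_outer co _ _ _ _ _ Hco D1 D2)).
  now rewrite line_0.
Qed.

(** The Laplacian of f f^H, by the product rule. *)
Lemma lapD_outer co (f : R2 -> C3) p :
  In co [co1; co2; co3] -> class_C 2 (fun _ => True) f ->
  lapD (fun q => outer co (f q) (f q)) p =
  plus (plus (outer co (lapD f p) (f p)) (outer co (f p) (lapD f p)))
    (scal 2 (plus (outer co (dirD f p e_s) (dirD f p e_s))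
                  (outer co (dirD f p e_t) (dirD f p e_t)))).
Proof.
intros Hco Hf. unfold lapD at 1. rewrite !(dirD2_outer co f) by auto.
unfold lapD. rewrite outer_plus_l, outer_plus_r by exact Hco.
match goal with |- plus (plus (plus ?a ?b) (plus ?b ?c)) (plus (plus ?d ?e) (plus ?e ?h)) = _ =>
  generalize a b c d e h end.
clear. intros a b c d e h. apply C3_eq, forall_coords.
c3 a; c3 b; c3 c; c3 d; c3 e; c3 h.
unfold re1, im1, re2, im2, re3, im3, co1, co2, co3, scal, plus.
simpl. unfold scal, plus. simpl. unfold mult. simpl. repeat split; ring.
Qed.

(** [phi] maps into the sphere, is conformal with factor [lam], its derivatives are
    Hermitian-orthogonal to [phi], and its Laplacian is [mu phi].  [ld_lin] is the
    linearity of the derivative in the direction. *)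
Record legendrian_data (phi : R2 -> C3) (lam mu : R2 -> R) : Prop := {
  ld_smooth : smooth (fun _ => True) phi;
  ld_sphere : forall p, on_sphere (phi p);
  ld_lin : forall p X, dirD phi p X =
     plus (scal (fst X) (dirD phi p e_s)) (scal (snd X) (dirD phi p e_t));
  ld_st : forall p, g (dirD phi p e_s) (dirD phi p e_t) = 0;
  ld_ss : forall p, g (dirD phi p e_s) (dirD phi p e_s) = lam p;
  ld_tt : forall p, g (dirD phi p e_t) (dirD phi p e_t) = lam p;
  ld_leg_s : forall p, herm (dirD phi p e_s) (phi p) = RtoC 0;
  ld_leg_t : forall p, herm (dirD phi p e_t) (phi p) = RtoC 0;
  ld_lap : forall p, lapD phi p = scal (mu p) (phi p) }.

Section Legendrian.
Context (phi : R2 -> C3) (lam mu : R2 -> R) (L : legendrian_data phi lam mu).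

Lemma g_dirD p X Y : g (dirD phi p X) (dirD phi p Y) = lam p * dot2 X Y.
Proof.
rewrite (ld_lin _ _ _ L p X), (ld_lin _ _ _ L p Y).
rewrite !g_plus_l, !g_plus_r, !g_scal_l, !g_scal_r.
rewrite (g_sym (dirD phi p e_t) (dirD phi p e_s)).
rewrite (ld_st _ _ _ L), (ld_ss _ _ _ L), (ld_tt _ _ _ L).
unfold dot2. ring.
Qed.

Lemma legendrian_factor_nonneg p : 0 <= lam p.
Proof.
rewrite <- (ld_ss _ _ _ L p), g_coords.
generalize (dirD phi p e_s). intros x.
repeat apply Rplus_le_le_0_compat; apply Rle_0_sqr.
Qed.

Lemma legendrian_smooth_S5 : smooth_map S5 (fun _ => True) phi.
Proof.
split; [apply (ld_smooth _ _ _ L) | ]. intros p _. apply (ld_sphere _ _ _ L).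
Qed.

Lemma legendrian_conformal_S5 : conformal S5 phi.
Proof.
split; [apply legendrian_smooth_S5 | ]. intros p. exists (lam p).
split; [apply legendrian_factor_nonneg | ]. intros X Y. apply g_dirD.
Qed.

Lemma legendrian_harmonic_S5 : harmonic S5 phi.
Proof.
apply harmonic_S5; [apply legendrian_smooth_S5 | ]. intros p X HX.
rewrite (ld_lap _ _ _ L), g_scal_l, HX. ring.
Qed.

Lemma legendrian_lift p : local_lift (fun q => hopf (phi q)) p phi.
Proof.
exists (fun _ => True). split; [apply open_all | split; [exact I | split]].
- apply (ld_smooth _ _ _ L).
- intros q _. split; [apply (ld_sphere _ _ _ L) | reflexivity].
Qed.

Lemma legendrian_smooth_CP2 : smooth_map CP2 (fun _ => True) (fun q => hopf (phi q)).
Proof. intros p _. exists phi. apply legendrian_lift. Qed.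

Lemma legendrian_conformal_CP2 : conformal CP2 (fun q => hopf (phi q)).
Proof.
split; [apply legendrian_smooth_CP2 | ]. intros p. exists (lam p).
split; [apply legendrian_factor_nonneg | ]. intros X Y.
rewrite (pullback_CP2 _ p phi) by apply legendrian_lift.
rewrite g_hor by apply (ld_sphere _ _ _ L).
assert (H : Im (herm (dirD phi p X) (phi p)) = 0).
{ rewrite (ld_lin _ _ _ L p X), herm_plus_l, !herm_scal_l.
  rewrite (ld_leg_s _ _ _ L), (ld_leg_t _ _ _ L). simpl. ring. }
rewrite H, Rmult_0_l, Rminus_0_r. apply g_dirD.
Qed.

Lemma hs_tangent a x X : herm a x = RtoC 0 ->
  hs (fun co => outer co a a) (fun co => plus (outer co X x) (outer co x X)) = 0.
Proof.
intros Ha. rewrite hs_plus_r, !hs_outer, Ha. destruct (herm a X).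
unfold Re, Cmult, Cconj, RtoC. simpl. ring.
Qed.

Lemma hs_radial x X : g x X = 0 -> g x x = 1 ->
  hs (fun co => outer co x x) (fun co => plus (outer co X x) (outer co x X)) = 0.
Proof.
intros HX Hx. rewrite hs_plus_r, !hs_outer, herm_self, Hx.
change (Re (herm x X) = 0) in HX. destruct (herm x X).
unfold Re, Cmult, Cconj, RtoC in *. simpl in *. subst. ring.
Qed.

Lemma legendrian_harmonic_CP2 : harmonic CP2 (fun q => hopf (phi q)).
Proof.
apply harmonic_CP2; [apply legendrian_smooth_CP2 | ].
intros p x X Hx Hux HX.
(* The lift passes through x, which agrees with phi p only up to a phase c. *)
destruct (hopf_eq_cscal _ _ (ld_sphere _ _ _ L p) Hx Hux) as (c & Hc & He).
assert (Hleg : forall a, herm a (phi p) = RtoC 0 -> herm a x = RtoC 0).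
{ intros a Ha. rewrite He, herm_cscal_r in Ha.
  transitivity ((c * Cconj c) * herm a x)%C.
  - rewrite Hc. ring.
  - rewrite <- Cmult_assoc, Ha. ring. }
rewrite (hs_ext _ (fun co => plus (scal (2 * mu p) (outer co x x))
  (scal 2 (plus (outer co (dirD phi p e_s) (dirD phi p e_s))
                (outer co (dirD phi p e_t) (dirD phi p e_t)))))).
- rewrite hs_plus_l, !hs_scal_l, hs_plus_l.
  rewrite hs_radial by assumption.
  rewrite (hs_tangent (dirD phi p e_s)) by apply Hleg, (ld_leg_s _ _ _ L).
  rewrite (hs_tangent (dirD phi p e_t)) by apply Hleg, (ld_leg_t _ _ _ L).
  ring.
- intros co Hco.
  transitivity (lapD (fun q => outer co (phi q) (phi q)) p).
  + apply lapD_ext. intros q.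
    apply proj_hopf; [exact Hco | apply (ld_sphere _ _ _ L)].
  + rewrite lapD_outer by (auto; apply (ld_smooth _ _ _ L)).
    f_equal. rewrite (ld_lap _ _ _ L), outer_scal_l, outer_scal_r by exact Hco.
    rewrite He, outer_cscal by assumption.
    refine (eq_trans (eq_sym (scal_distr_r (K := R_AbsRing) _ _ _)) _).
    f_equal. unfold plus. simpl. ring.
Qed.
End Legendrian.

(** * Relations between the coefficients *)

(** Consequences of the orthonormality of (beta_j), (gamma_j) and (1,1,1)/sqrt 3.
    They are applied a second time with beta and gamma exchanged.  The module
    confines the notations attached to [nsatz]. *)
Module Identities.
Import Nsatz.
Local Open Scope R_scope.
Section Ids.
Context (b1 b2 b3 g1 g2 g3 v w : R).
Context (Hb : b1 + b2 + b3 = 0) (Hg : g1 + g2 + g3 = 0).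
Context (H1 : b1 * b1 + g1 * g1 = 2 / 3) (H2 : b2 * b2 + g2 * g2 = 2 / 3)
  (H3 : b3 * b3 + g3 * g3 = 2 / 3).
Context (Hbg : b1 * g1 + b2 * g2 + b3 * g3 = 0)
  (Hbb : b1 * b1 + b2 * b2 + b3 * b3 = 1).

Lemma id_norm_s :
  b1 * b1 * ((b2 * v + 1) * (b3 * v + 1)) * (g1 * w + 1) +
  b2 * b2 * ((b3 * v + 1) * (b1 * v + 1)) * (g2 * w + 1) +
  b3 * b3 * ((b1 * v + 1) * (b2 * v + 1)) * (g3 * w + 1) =
  1 - 3 * (b1 * b2 * b3) * v - 3 * (g1 * g2 * g3) * w.
Proof. nsatz. Qed.

Lemma id_norm : (b1 * v + 1) * (g1 * w + 1) + (b2 * v + 1) * (g2 * w + 1) +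
  (b3 * v + 1) * (g3 * w + 1) = 3.
Proof. clear - Hb Hg Hbg. nsatz. Qed.

Lemma id_b3 : b1 * b1 * b1 + b2 * b2 * b2 + b3 * b3 * b3 = 3 * (b1 * b2 * b3).
Proof. clear - Hb. nsatz. Qed.

Lemma id_bgg :
  b1 * (g1 * g1) + b2 * (g2 * g2) + b3 * (g3 * g3) = - 3 * (b1 * b2 * b3).
Proof. clear - Hb H1 H2 H3. nsatz. Qed.

Lemma id_second_coef :
  b1 * (b2 * (b3 * v + 1) + b3 * (b2 * v + 1)) = 2 * (b1 * b2 * b3) * v - b1 * b1.
Proof. clear - Hb. nsatz. Qed.
End Ids.
End Identities.
Import Identities.

Lemma beta_gamma_relations theta b1 b2 b3 g1 g2 g3 :
  b1 = beta1 theta -> b2 = beta2 theta -> b3 = beta3 theta ->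
  g1 = gamma1 theta -> g2 = gamma2 theta -> g3 = gamma3 theta ->
  b1 + b2 + b3 = 0 /\ g1 + g2 + g3 = 0 /\
  b1 * b1 + g1 * g1 = 2 / 3 /\ b2 * b2 + g2 * g2 = 2 / 3 /\
  b3 * b3 + g3 * g3 = 2 / 3 /\
  b1 * g1 + b2 * g2 + b3 * g3 = 0 /\ b1 * b1 + b2 * b2 + b3 * b3 = 1.
Proof.
intros -> -> -> -> -> ->.
unfold beta1, beta2, beta3, gamma1, gamma2, gamma3.
replace (2 / sqrt 6) with (2 * (1 / sqrt 6)) by (unfold Rdiv; ring).
assert (Hu : forall x, 0 < x -> 1 / sqrt x * (1 / sqrt x) = 1 / x).
{ intros x Hx. assert (Hs := sqrt_sqrt x (Rlt_le _ _ Hx)).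
  rewrite <- Hs at 3. field. apply Rgt_not_eq, sqrt_lt_R0, Hx. }
assert (U := Hu 2 ltac:(lra)). assert (W := Hu 6 ltac:(lra)). clear Hu.
assert (CS := sin2_cos2 theta). unfold Rsqr in CS.
revert U W CS.
generalize (1 / sqrt 2) (1 / sqrt 6) (sin theta) (cos theta).
intros u w s c U W CS.
assert (C2 : c * c = 1 - s * s) by lra.
repeat split.
- ring.
- ring.
- transitivity ((u * u + w * w) * (s * s + c * c)); [ring | rewrite U, W, CS; lra].
- transitivity ((u * u + w * w) * (s * s + c * c)); [ring | rewrite U, W, CS; lra].
- transitivity (4 * (w * w) * (s * s + c * c)); [ring | rewrite W, CS; lra].
- transitivity (c * s * (6 * (w * w) - 2 * (u * u))); [ring | rewrite U, W; lra].
- transitivity (2 * (u * u) * (c * c) + 6 * (w * w) * (s * s));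
    [ring | rewrite U, W, C2; lra].
Qed.

(** * Products of solutions of the differential equations *)

(** The squared modulus. *)
Definition norm2 (z : C) : R := fst z * fst z + snd z * snd z.

Lemma Cmod_norm2 z : Cmod z ^ 2 = norm2 z.
Proof.
unfold Cmod, norm2. rewrite pow2_sqrt; [ring | nra].
Qed.

(** The right-hand side of the differential equations for (y_j) and (z_j). *)
Definition cross (b1 b2 b3 : R) (y : C3) : C3 :=
  mkC3 (RtoC b1 * Cconj (co2 y * co3 y))%C (RtoC b2 * Cconj (co3 y * co1 y))%C
    (RtoC b3 * Cconj (co1 y * co2 y))%C.

(** The componentwise product of C^3. *)
Definition cmul (x y : C3) : C3 :=
  mkC3 (co1 x * co1 y)%C (co2 x * co2 y)%C (co3 x * co3 y)%C.

(** Multiplication of the components by three real numbers. *)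
Definition rmul (e1 e2 e3 : R) (y : C3) : C3 :=
  mkC3 (RtoC e1 * co1 y)%C (RtoC e2 * co2 y)%C (RtoC e3 * co3 y)%C.

Lemma is_derive3_cmul_l (f : R -> C3) (z : C3) x l :
  is_derive3 f x l -> is_derive3 (fun y => cmul (f y) z) x (cmul l z).
Proof.
rewrite !is_derive3_parts. intros (H1 & H2 & H3).
assert (K : forall (h : R -> C) m c, is_deriveC h x m ->
  is_deriveC (fun y => (h y * c)%C) x (m * c)%C).
{ intros h m c H.
  apply (is_deriveC_eq _ _ _ _ (is_deriveC_mult _ _ _ _ _ H (is_deriveC_const c x))).
  ring. }
split; [ | split]; now apply K.
Qed.

Lemma cmul_comm x y : cmul x y = cmul y x.
Proof.
unfold cmul.
now rewrite (Cmult_comm (co1 x)), (Cmult_comm (co2 x)), (Cmult_comm (co3 x)).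
Qed.

Lemma is_derive3_cmul (f h : R -> C3) x l m :
  is_derive3 f x l -> is_derive3 h x m ->
  is_derive3 (fun y => cmul (f y) (h y)) x (plus (cmul l (h x)) (cmul (f x) m)).
Proof.
rewrite !is_derive3_parts. intros (H1 & H2 & H3) (K1 & K2 & K3).
split; [ | split].
- apply (is_deriveC_mult _ _ _ _ _ H1 K1).
- apply (is_deriveC_mult _ _ _ _ _ H2 K2).
- apply (is_deriveC_mult _ _ _ _ _ H3 K3).
Qed.

Lemma is_derive3_affine (f : R -> C3) s X l :
  is_derive3 f s l -> is_derive3 (fun h => f (s + h * X)) 0 (scal X l).
Proof.
intros H.
apply (is_derive_comp (K := R_AbsRing) (V := C3) f (fun h => s + h * X) 0 l X).
- now rewrite Rmult_0_l, Rplus_0_r.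
- auto_derive; [exact I | ring].
Qed.

Lemma is_derive3_scal (r : R) (f : R -> C3) x l :
  is_derive3 f x l -> is_derive3 (fun y => scal r (f y)) x (scal r l).
Proof.
apply (is_derive_linear (V := C3) (W := C3) (fun y => scal r y)).
exact (is_linear_scal_r (K := R_AbsRing) (V := C3) r Rmult_comm).
Qed.

(** The derivative of kap Y(s) * Z(t). *)
Lemma dirD_separated (kap : R) (Y Z : R -> C3) (p X : R2) l m :
  is_derive3 Y (fst p) l -> is_derive3 Z (snd p) m ->
  dirD (fun q : R2 => scal kap (cmul (Y (fst q)) (Z (snd q)))) p X =
  plus (scal (fst X) (scal kap (cmul l (Z (snd p)))))
       (scal (snd X) (scal kap (cmul (Y (fst p)) m))).
Proof.
intros HY HZ. apply is_derive3_dirD.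
assert (K := is_derive3_scal kap _ _ _ (is_derive3_cmul _ _ _ _ _
  (is_derive3_affine _ _ (fst X) _ HY) (is_derive3_affine _ _ (snd X) _ HZ))).
refine (eq_rect _ (fun l => is_derive3 _ 0 l) K _ _).
rewrite !Rmult_0_l, !Rplus_0_r. clear.
generalize (fst X) (snd X) (Z (snd p)) (Y (fst p)). clear. intros a b z y.
c3 l; c3 m; c3 y; c3 z. apply C3_eq, forall_coords.
unfold re1, im1, re2, im2, re3, im3, cmul, mkC3, co1, co2, co3, Cmult, scal, plus.
simpl. unfold scal, plus. simpl. unfold mult. simpl. repeat split; ring.
Qed.

Section ODE.
Context (b1 b2 b3 : R) (Y : R -> C3).
Context (HY : forall s, is_derive3 Y s (cross b1 b2 b3 (Y s))).

(** The second derivative of a solution: y_j'' = (2 b1 b2 b3 v - b_j^2) y_j. *)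
Lemma ode_second (v : R -> R) s :
  b1 + b2 + b3 = 0 ->
  norm2 (co1 (Y s)) = b1 * v s + 1 ->
  norm2 (co2 (Y s)) = b2 * v s + 1 ->
  norm2 (co3 (Y s)) = b3 * v s + 1 ->
  is_derive3 (fun s => cross b1 b2 b3 (Y s)) s
   (rmul (2 * (b1 * b2 * b3) * v s - b1 * b1)
         (2 * (b1 * b2 * b3) * v s - b2 * b2)
         (2 * (b1 * b2 * b3) * v s - b3 * b3) (Y s)).
Proof.
intros Hb N1 N2 N3.
assert (H := HY s). rewrite is_derive3_parts in H. destruct H as (D1 & D2 & D3).
rewrite <- (id_second_coef b1 b2 b3 (v s)) by exact Hb.
replace (2 * (b1 * b2 * b3) * v s - b2 * b2) with
  (b2 * (b3 * (b1 * v s + 1) + b1 * (b3 * v s + 1)))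
  by (rewrite id_second_coef by (rewrite <- Hb; ring); ring).
replace (2 * (b1 * b2 * b3) * v s - b3 * b3) with
  (b3 * (b1 * (b2 * v s + 1) + b2 * (b1 * v s + 1)))
  by (rewrite id_second_coef by (rewrite <- Hb; ring); ring).
rewrite <- N1, <- N2, <- N3.
assert (K : forall (r : R) (f h : R -> C) l m, is_deriveC f s l -> is_deriveC h s m ->
  is_deriveC (fun s => (RtoC r * Cconj (f s * h s))%C) s
    (RtoC r * Cconj (l * h s + f s * m))%C).
{ intros r f h l m Hf Hh.
  apply (is_deriveC_eq _ _ _ _ (is_deriveC_mult _ _ _ _ _ (is_deriveC_const (RtoC r) s)
    (is_deriveC_conj _ _ _ (is_deriveC_mult _ _ _ _ _ Hf Hh)))).
  ring. }
rewrite is_derive3_parts.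
unfold cross, rmul, mkC3 in *. cbn [co1 co2 co3 fst snd] in *.
split; [ | split].
- refine (is_deriveC_eq _ _ _ _ (K b1 _ _ _ _ D2 D3) _).
  destruct (Y s) as [[[? ?] [? ?]] [? ?]].
  unfold norm2, co1, co2, co3, Cmult, Cconj, Cplus, RtoC. simpl. f_equal; ring.
- refine (is_deriveC_eq _ _ _ _ (K b2 _ _ _ _ D3 D1) _).
  destruct (Y s) as [[[? ?] [? ?]] [? ?]].
  unfold norm2, co1, co2, co3, Cmult, Cconj, Cplus, RtoC. simpl. f_equal; ring.
- refine (is_deriveC_eq _ _ _ _ (K b3 _ _ _ _ D1 D2) _).
  destruct (Y s) as [[[? ?] [? ?]] [? ?]].
  unfold norm2, co1, co2, co3, Cmult, Cconj, Cplus, RtoC. simpl. f_equal; ring.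
Qed.

(** The derivatives of a solution are polynomials in the solution and its conjugate,
    so regularity follows by induction on the order. *)
Lemma ode_smooth {E : NormedModule R_AbsRing} (pr : E -> R) k :
  is_linear (V := R_NormedModule) pr ->
  classCx k (fun _ => True) (fun p => co1 (Y (pr p))) /\
  classCx k (fun _ => True) (fun p => co2 (Y (pr p))) /\
  classCx k (fun _ => True) (fun p => co3 (Y (pr p))).
Proof.
intros Hpr.
assert (Hc : forall p c, In c coords -> continuous (fun p => c (Y (pr p))) p).
{ intros p c Hc.
  apply (continuous_comp pr (fun s => c (Y s))).
  - apply (linear_cont (V := R_NormedModule) pr p Hpr).
  - apply (ex_derive_continuous (V := R_NormedModule) (fun s => c (Y s))).
    eexists. exact (proj2 (is_derive3_coords Y _ _) (HY (pr p)) c Hc). }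
assert (Hd : forall p X, is_derive3 (fun h : R => Y (pr (plus p (scal h X)))) 0
   (scal (pr X) (cross b1 b2 b3 (Y (pr p))))).
{ intros p X.
  apply (is_derive_ext (V := C3) (fun h : R => Y (pr p + h * pr X))).
  - intros h. f_equal. rewrite (linear_plus _ Hpr), (linear_scal _ Hpr). reflexivity.
  - now apply is_derive3_affine. }
assert (Hiff : forall k, (classCx k (fun _ => True) (fun p => co1 (Y (pr p))) /\
  classCx k (fun _ => True) (fun p => co2 (Y (pr p))) /\
  classCx k (fun _ => True) (fun p => co3 (Y (pr p)))) <->
  class_C k (fun _ => True) (fun p => Y (pr p))).
{ intros j. now rewrite class_C_co by apply open_all. }
apply Hiff. induction k.
- split; [ | exact I]. intros p _. apply continuous_coords. auto.
- split.
  + intros p _. apply continuous_coords. auto.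
  + intros X. exists (fun p => scal (pr X) (cross b1 b2 b3 (Y (pr p)))).
    split; [intros p _; apply Hd | ].
    apply Hiff in IHk. destruct IHk as (I1 & I2 & I3).
    apply class_C_co; [apply open_all | ].
    assert (K : forall (r : R) f h, classCx k (fun _ : E => True) f ->
      classCx k (fun _ : E => True) h ->
      classCx k (fun _ : E => True)
        (fun p => (RtoC (pr X) * (RtoC r * Cconj (f p * h p)))%C)).
    { intros r f h Hf Hh. apply classCx_mult; [apply classCx_const | ].
      apply classCx_mult; [apply classCx_const | ].
      apply classCx_conj. now apply classCx_mult. }
    assert (KE : forall (r : R) (z : C), (RtoC r * z)%C = scal r (z : C_R_NormedModule)).
    { intros r z. now rewrite Cmult_RtoC_l. }
    split; [ | split].
    * apply (classCx_ext k _ _ _ open_all (fun p _ => KE _ _) (K b1 _ _ I2 I3)).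
    * apply (classCx_ext k _ _ _ open_all (fun p _ => KE _ _) (K b2 _ _ I3 I1)).
    * apply (classCx_ext k _ _ _ open_all (fun p _ => KE _ _) (K b3 _ _ I1 I2)).
Qed.
End ODE.

Lemma g_cmul kap y z :
  g (scal kap (cmul y z)) (scal kap (cmul y z)) =
  kap * kap * (norm2 (co1 y) * norm2 (co1 z) + norm2 (co2 y) * norm2 (co2 z) +
    norm2 (co3 y) * norm2 (co3 z)).
Proof.
rewrite g_scal_l, g_scal_r, g_coords, Rmult_assoc. do 2 f_equal.
c3 y; c3 z. unfold norm2, cmul, mkC3, re1, im1, re2, im2, re3, im3, co1, co2, co3, Cmult.
simpl. ring.
Qed.

Lemma g_cmul_cross kap b1 b2 b3 y z :
  g (scal kap (cmul (cross b1 b2 b3 y) z)) (scal kap (cmul (cross b1 b2 b3 y) z)) =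
  kap * kap * (b1 * b1 * (norm2 (co2 y) * norm2 (co3 y)) * norm2 (co1 z) +
    b2 * b2 * (norm2 (co3 y) * norm2 (co1 y)) * norm2 (co2 z) +
    b3 * b3 * (norm2 (co1 y) * norm2 (co2 y)) * norm2 (co3 z)).
Proof.
rewrite g_scal_l, g_scal_r, g_coords, Rmult_assoc. do 2 f_equal.
c3 y; c3 z. unfold norm2, cmul, cross, mkC3, re1, im1, re2, im2, re3, im3, co1, co2, co3,
  Cmult, Cconj, RtoC.
simpl. ring.
Qed.

Lemma g_cmul_cross_cross kap b1 b2 b3 g1 g2 g3 y z :
  g (scal kap (cmul (cross b1 b2 b3 y) z)) (scal kap (cmul y (cross g1 g2 g3 z))) =
  kap * kap * Re (Cconj (co1 y * co2 y * co3 y) * (co1 z * co2 z * co3 z))%C *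
    (b1 * g1 + b2 * g2 + b3 * g3).
Proof.
rewrite g_scal_l, g_scal_r, g_coords, !Rmult_assoc. do 2 f_equal.
c3 y; c3 z. unfold cmul, cross, mkC3, re1, im1, re2, im2, re3, im3, co1, co2, co3,
  Cmult, Cconj, RtoC, Re, Im.
simpl. ring.
Qed.

(** The last factor vanishes for the cone, where |z_j|^2 = gamma_j w + 1; this is
    the Legendrian condition. *)
Lemma herm_cmul_cross kap b1 b2 b3 y z :
  herm (scal kap (cmul (cross b1 b2 b3 y) z)) (scal kap (cmul y z)) =
  (RtoC (kap * kap) * Cconj (co1 y * co2 y * co3 y) *
    RtoC (b1 * norm2 (co1 z) + b2 * norm2 (co2 z) + b3 * norm2 (co3 z)))%C.
Proof.
rewrite herm_scal_l, herm_sym, herm_scal_l.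
transitivity (RtoC kap * RtoC kap * herm (cmul (cross b1 b2 b3 y) z) (cmul y z))%C.
{ rewrite (herm_sym (cmul y z)).
  destruct (herm (cmul y z) (cmul (cross b1 b2 b3 y) z)).
  unfold Cmult, Cconj, RtoC. simpl. f_equal; ring. }
rewrite <- RtoC_mult, <- !Cmult_assoc. f_equal.
c3 y; c3 z. unfold herm, norm2, cmul, cross, mkC3, co1, co2, co3, Cmult, Cplus, Cconj, RtoC.
simpl. f_equal; ring.
Qed.

(** The two second derivatives add up to a multiple of Y * Z as soon as e_j + f_j
    does not depend on j. *)
Lemma lap_cmul kap e1 e2 e3 f1 f2 f3 mu y z :
  e1 + f1 = mu -> e2 + f2 = mu -> e3 + f3 = mu ->
  plus (scal kap (cmul (rmul e1 e2 e3 y) z)) (scal kap (cmul y (rmul f1 f2 f3 z))) =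
  scal mu (scal kap (cmul y z)).
Proof.
intros H1 H2 H3. replace f1 with (mu - e1) by lra. replace f2 with (mu - e2) by lra.
replace f3 with (mu - e3) by lra. clear.
c3 y; c3 z. apply C3_eq, forall_coords.
unfold re1, im1, re2, im2, re3, im3, cmul, rmul, mkC3, co1, co2, co3, Cmult, RtoC,
  scal, plus.
simpl. unfold scal, plus. simpl. unfold mult. simpl. repeat split; ring.
Qed.

(** * The cone *)

Theorem theorem5p4 (theta : R) (htheta : 0 <= theta < 2 * PI)
    (y1 y2 y3 : R -> C) (v : R -> R) (z1 z2 z3 : R -> C) (w : R -> R)
    (b1 b2 b3 g1 g2 g3 : R)
    (hb1 : b1 = beta1 theta) (hb2 : b2 = beta2 theta) (hb3 : b3 = beta3 theta)
    (hg1 : g1 = gamma1 theta) (hg2 : g2 = gamma2 theta) (hg3 : g3 = gamma3 theta)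
    (hy1 : forall s, is_deriveC y1 s (RtoC b1 * Cconj (y2 s * y3 s))%C)
    (hy2 : forall s, is_deriveC y2 s (RtoC b2 * Cconj (y3 s * y1 s))%C)
    (hy3 : forall s, is_deriveC y3 s (RtoC b3 * Cconj (y1 s * y2 s))%C)
    (hv1 : forall s, Cmod (y1 s) ^ 2 = b1 * v s + 1)
    (hv2 : forall s, Cmod (y2 s) ^ 2 = b2 * v s + 1)
    (hv3 : forall s, Cmod (y3 s) ^ 2 = b3 * v s + 1)
    (hz1 : forall t, is_deriveC z1 t (RtoC g1 * Cconj (z2 t * z3 t))%C)
    (hz2 : forall t, is_deriveC z2 t (RtoC g2 * Cconj (z3 t * z1 t))%C)
    (hz3 : forall t, is_deriveC z3 t (RtoC g3 * Cconj (z1 t * z2 t))%C)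
    (hw1 : forall t, Cmod (z1 t) ^ 2 = g1 * w t + 1)
    (hw2 : forall t, Cmod (z2 t) ^ 2 = g2 * w t + 1)
    (hw3 : forall t, Cmod (z3 t) ^ 2 = g3 * w t + 1) :
  let F := Phi y1 y2 y3 z1 z2 z3 in
  (forall r s t, g (F r s t) (F r s t) = r ^ 2) /\
  (exists a b c : R,
    (a = 1 / 6 * (b1 ^ 2 + b2 ^ 2 + b3 ^ 2) /\
     a = 1 / 6 * (g1 ^ 2 + g2 ^ 2 + g3 ^ 2) /\
     a = 1 / 6) /\
    (b = - (1 / 6) * (b1 ^ 3 + b2 ^ 3 + b3 ^ 3) /\
     b = 1 / 6 * (b1 * g1 ^ 2 + b2 * g2 ^ 2 + b3 * g3 ^ 2) /\
     b = - (1 / 2) * (b1 * b2 * b3)) /\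
    (c = 1 / 6 * (b1 ^ 2 * g1 + b2 ^ 2 * g2 + b3 ^ 2 * g3) /\
     c = - (1 / 6) * (g1 ^ 3 + g2 ^ 3 + g3 ^ 3) /\
     c = - (1 / 2) * (g1 * g2 * g3)) /\
    forall r s t, exists Fr Fs Ft : C3,
      is_derive3 (fun x => F x s t) r Fr /\
      is_derive3 (fun x => F r x t) s Fs /\
      is_derive3 (fun x => F r s x) t Ft /\
      g Fr Fs = 0 /\ g Fr Ft = 0 /\ g Fs Ft = 0 /\
      g Fr Fr = 1 /\
      g Fs Fs = 2 * r ^ 2 * (a + b * v s + c * w t) /\
      g Ft Ft = 2 * r ^ 2 * (a + b * v s + c * w t)) /\
  (let phi := fun p : R2 => F 1 (fst p) (snd p) in
   let psi := fun p : R2 => hopf (phi p) in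
   conformal S5 phi /\ harmonic S5 phi /\
   conformal CP2 psi /\ harmonic CP2 psi).
Proof.
intros F.
destruct (beta_gamma_relations theta b1 b2 b3 g1 g2 g3 hb1 hb2 hb3 hg1 hg2 hg3)
  as (Rb & Rg & R1 & R2' & R3' & Rbg & Rbb).
assert (Rgg : g1 * g1 + g2 * g2 + g3 * g3 = 1) by lra.
assert (Rgb : g1 * b1 + g2 * b2 + g3 * b3 = 0) by lra.
assert (Q1 : g1 * g1 + b1 * b1 = 2 / 3) by lra.
assert (Q2 : g2 * g2 + b2 * b2 = 2 / 3) by lra.
assert (Q3 : g3 * g3 + b3 * b3 = 2 / 3) by lra.
clear hb1 hb2 hb3 hg1 hg2 hg3 htheta theta.
set (k := 1 / sqrt 3).
assert (Hk : k * k = 1 / 3).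
{ unfold k. assert (Hs := sqrt_sqrt 3 ltac:(lra)). rewrite <- Hs at 3. field.
  apply Rgt_not_eq, sqrt_lt_R0. lra. }
set (Y := fun s => mkC3 (y1 s) (y2 s) (y3 s)).
set (Z := fun t => mkC3 (z1 t) (z2 t) (z3 t)).
assert (HF : forall r s t, F r s t = scal (k * r) (cmul (Y s) (Z t))).
{ intros r s t. unfold F, Phi. fold k. unfold Y, Z.
  destruct (y1 s), (y2 s), (y3 s), (z1 t), (z2 t), (z3 t).
  apply C3_eq, forall_coords.
  unfold re1, im1, re2, im2, re3, im3, cscal, cmul, mkC3, co1, co2, co3, Cmult, RtoC,
    scal.
  simpl. unfold scal. simpl. unfold mult. simpl. repeat split; ring. }
assert (HY : forall s, is_derive3 Y s (cross b1 b2 b3 (Y s))).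
{ intros s. apply is_derive3_parts.
  split; [apply hy1 | split; [apply hy2 | apply hy3]]. }
assert (HZ : forall t, is_derive3 Z t (cross g1 g2 g3 (Z t))).
{ intros t. apply is_derive3_parts.
  split; [apply hz1 | split; [apply hz2 | apply hz3]]. }
assert (N1 : forall s, norm2 (co1 (Y s)) = b1 * v s + 1)
  by (intros s; now rewrite <- hv1, Cmod_norm2).
assert (N2 : forall s, norm2 (co2 (Y s)) = b2 * v s + 1)
  by (intros s; now rewrite <- hv2, Cmod_norm2).
assert (N3 : forall s, norm2 (co3 (Y s)) = b3 * v s + 1)
  by (intros s; now rewrite <- hv3, Cmod_norm2).
assert (M1 : forall t, norm2 (co1 (Z t)) = g1 * w t + 1)
  by (intros t; now rewrite <- hw1, Cmod_norm2).
assert (M2 : forall t, norm2 (co2 (Z t)) = g2 * w t + 1)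
  by (intros t; now rewrite <- hw2, Cmod_norm2).
assert (M3 : forall t, norm2 (co3 (Z t)) = g3 * w t + 1)
  by (intros t; now rewrite <- hw3, Cmod_norm2).
clearbody F Y Z. clear hy1 hy2 hy3 hz1 hz2 hz3 hv1 hv2 hv3 hw1 hw2 hw3.
set (Ys := fun s => cross b1 b2 b3 (Y s)).
set (Zt := fun t => cross g1 g2 g3 (Z t)).
assert (G0 : forall kap s t,
  g (scal kap (cmul (Y s) (Z t))) (scal kap (cmul (Y s) (Z t))) = 3 * (kap * kap)).
{ intros kap s t. rewrite g_cmul, N1, N2, N3, M1, M2, M3.
  rewrite (id_norm b1 b2 b3 g1 g2 g3) by assumption. ring. }
assert (Gss : forall kap s t,
  g (scal kap (cmul (Ys s) (Z t))) (scal kap (cmul (Ys s) (Z t))) =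
  kap * kap * (1 - 3 * (b1 * b2 * b3) * v s - 3 * (g1 * g2 * g3) * w t)).
{ intros kap s t. unfold Ys. rewrite g_cmul_cross, N1, N2, N3, M1, M2, M3.
  now rewrite (id_norm_s b1 b2 b3 g1 g2 g3) by assumption. }
assert (Gtt : forall kap s t,
  g (scal kap (cmul (Y s) (Zt t))) (scal kap (cmul (Y s) (Zt t))) =
  kap * kap * (1 - 3 * (b1 * b2 * b3) * v s - 3 * (g1 * g2 * g3) * w t)).
{ intros kap s t. rewrite (cmul_comm (Y s)). unfold Zt.
  rewrite g_cmul_cross, N1, N2, N3, M1, M2, M3.
  rewrite (id_norm_s g1 g2 g3 b1 b2 b3) by assumption. ring. }
assert (Gst : forall kap s t,
  g (scal kap (cmul (Ys s) (Z t))) (scal kap (cmul (Y s) (Zt t))) = 0).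
{ intros kap s t. unfold Ys, Zt. rewrite g_cmul_cross_cross, Rbg. ring. }
assert (Ls : forall kap s t,
  herm (scal kap (cmul (Ys s) (Z t))) (scal kap (cmul (Y s) (Z t))) = RtoC 0).
{ intros kap s t. unfold Ys. rewrite herm_cmul_cross, M1, M2, M3.
  replace (b1 * (g1 * w t + 1) + b2 * (g2 * w t + 1) + b3 * (g3 * w t + 1))
    with ((b1 * g1 + b2 * g2 + b3 * g3) * w t + (b1 + b2 + b3)) by ring.
  rewrite Rbg, Rb, Rmult_0_l, Rplus_0_l. ring. }
assert (Lt : forall kap s t,
  herm (scal kap (cmul (Y s) (Zt t))) (scal kap (cmul (Y s) (Z t))) = RtoC 0).
{ intros kap s t. unfold Zt. rewrite !(cmul_comm (Y s)), herm_cmul_cross, N1, N2, N3.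
  replace (g1 * (b1 * v s + 1) + g2 * (b2 * v s + 1) + g3 * (b3 * v s + 1))
    with ((g1 * b1 + g2 * b2 + g3 * b3) * v s + (g1 + g2 + g3)) by ring.
  rewrite Rgb, Rg, Rmult_0_l, Rplus_0_l. ring. }
split; [ | split].
- intros r s t. rewrite HF, G0.
  replace (3 * (k * r * (k * r))) with (3 * (k * k) * r ^ 2) by ring.
  rewrite Hk. lra.
- exists (1 / 6), (- (1 / 2) * (b1 * b2 * b3)), (- (1 / 2) * (g1 * g2 * g3)).
  split; [ | split; [ | split]].
  + simpl. rewrite !Rmult_1_r, Rbb, Rgg. lra.
  + simpl. rewrite !Rmult_1_r.
    assert (I1 := id_b3 b1 b2 b3 Rb).
    assert (I2 := id_bgg b1 b2 b3 g1 g2 g3 Rb R1 R2' R3').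
    lra.
  + simpl. rewrite !Rmult_1_r.
    assert (I1 := id_b3 g1 g2 g3 Rg).
    assert (I2 := id_bgg g1 g2 g3 b1 b2 b3 Rg Q1 Q2 Q3).
    lra.
  + intros r s t.
    exists (scal k (cmul (Y s) (Z t))), (scal (k * r) (cmul (Ys s) (Z t))),
      (scal (k * r) (cmul (Y s) (Zt t))).
    assert (Hr : forall x, scal (k * r) x = scal r (scal k x : C3)).
    { intros x. rewrite Rmult_comm. symmetry. apply (scal_assoc (K := R_AbsRing)). }
    split; [ | split; [ | split]].
    * apply (is_derive_ext (V := C3) (fun x : R => scal x (scal k (cmul (Y s) (Z t)) : C3))).
      { intros x. rewrite HF, Rmult_comm. apply (scal_assoc (K := R_AbsRing)). }
      generalize (is_derive_scal_l (K := R_AbsRing) (V := C3) (fun x : R => x) r 1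
        (scal k (cmul (Y s) (Z t))) (is_derive_id r)).
      intros H. refine (eq_rect _ (fun l => is_derive3 _ r l) H _ _).
      apply (scal_one (K := R_AbsRing)).
    * apply (is_derive_ext (V := C3) (fun x => scal (k * r) (cmul (Y x) (Z t)))).
      { intros x. now rewrite HF. }
      apply is_derive3_scal, is_derive3_cmul_l, HY.
    * apply (is_derive_ext (V := C3) (fun x => scal (k * r) (cmul (Z x) (Y s)))).
      { intros x. now rewrite HF, cmul_comm. }
      rewrite cmul_comm. apply is_derive3_scal, is_derive3_cmul_l, HZ.
    * assert (E1 := f_equal fst (Ls k s t)). assert (E2 := f_equal fst (Lt k s t)).
      change (g (scal k (cmul (Ys s) (Z t))) (scal k (cmul (Y s) (Z t))) = 0) in E1.
      change (g (scal k (cmul (Y s) (Zt t))) (scal k (cmul (Y s) (Z t))) = 0) in E2.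
      rewrite !Gss, !Gtt, Gst, G0, !Hr.
      rewrite (g_scal_r r _ (scal k (cmul (Ys s) (Z t)))),
        (g_scal_r r _ (scal k (cmul (Y s) (Zt t)))).
      rewrite (g_sym _ (scal k (cmul (Ys s) (Z t)))),
        (g_sym _ (scal k (cmul (Y s) (Zt t)))), E1, E2.
      replace (k * r * (k * r)) with (k * k * r ^ 2) by ring. rewrite Hk.
      repeat split; try lra; field.
- intros phi psi.
  assert (Ephi : forall p, phi p = scal k (cmul (Y (fst p)) (Z (snd p)))).
  { intros p. unfold phi. now rewrite HF, Rmult_1_r. }
  assert (HYs : forall s, is_derive3 Ys s
    (rmul (2 * (b1 * b2 * b3) * v s - b1 * b1) (2 * (b1 * b2 * b3) * v s - b2 * b2)
       (2 * (b1 * b2 * b3) * v s - b3 * b3) (Y s))).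
  { intros s. now apply ode_second. }
  assert (HZt : forall t, is_derive3 Zt t
    (rmul (2 * (g1 * g2 * g3) * w t - g1 * g1) (2 * (g1 * g2 * g3) * w t - g2 * g2)
       (2 * (g1 * g2 * g3) * w t - g3 * g3) (Z t))).
  { intros t. now apply ode_second. }
  assert (Dphi : forall p X, dirD phi p X =
    plus (scal (fst X) (scal k (cmul (Ys (fst p)) (Z (snd p)))))
         (scal (snd X) (scal k (cmul (Y (fst p)) (Zt (snd p)))))).
  { intros p X. rewrite (dirD_ext phi
      (fun q : R2 => scal k (cmul (Y (fst q)) (Z (snd q)))) p X Ephi).
    now apply dirD_separated. }
  assert (K10 : forall x y : C3, plus (scal 1 x) (scal 0 y) = x).
  { intros x y. refine (eq_trans (f_equal2 plus (scal_one (K := R_AbsRing) x)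
      (scal_zero_l (K := R_AbsRing) y)) (plus_zero_r x)). }
  assert (K01 : forall x y : C3, plus (scal 0 x) (scal 1 y) = y).
  { intros x y. refine (eq_trans (f_equal2 plus (scal_zero_l (K := R_AbsRing) x)
      (scal_one (K := R_AbsRing) y)) (plus_zero_l y)). }
  assert (Ds : forall p, dirD phi p e_s = scal k (cmul (Ys (fst p)) (Z (snd p)))).
  { intros p. rewrite Dphi. apply K10. }
  assert (Dt : forall p, dirD phi p e_t = scal k (cmul (Y (fst p)) (Zt (snd p)))).
  { intros p. rewrite Dphi. apply K01. }
  assert (HL : legendrian_data phi
    (fun p => k * k * (1 - 3 * (b1 * b2 * b3) * v (fst p) -
       3 * (g1 * g2 * g3) * w (snd p)))
    (fun p => 2 * (b1 * b2 * b3) * v (fst p) + 2 * (g1 * g2 * g3) * w (snd p) - 2 / 3)).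
  { split.
    - intros j. apply class_C_co; [apply open_all | ].
      destruct (ode_smooth b1 b2 b3 Y HY (fst : R2 -> R) j) as (S1 & S2 & S3).
      { apply (@is_linear_fst R_AbsRing R_NormedModule R_NormedModule). }
      destruct (ode_smooth g1 g2 g3 Z HZ (snd : R2 -> R) j) as (T1 & T2 & T3).
      { apply (@is_linear_snd R_AbsRing R_NormedModule R_NormedModule). }
      assert (K : forall f h u : R2 -> C, (forall p, u p = (RtoC k * (f p * h p))%C) ->
        classCx j (fun _ => True) f -> classCx j (fun _ => True) h ->
        classCx j (fun _ => True) u).
      { intros f h u He Hf Hh.
        apply (classCx_ext j _ (fun p => (RtoC k * (f p * h p))%C)); auto using open_all.
        apply classCx_mult; [apply classCx_const | now apply classCx_mult]. }
      split; [ | split].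
      + apply (K _ _ _ (fun p => eq_trans (f_equal co1 (Ephi p))
          (eq_sym (Cmult_RtoC_l k _))) S1 T1).
      + apply (K _ _ _ (fun p => eq_trans (f_equal co2 (Ephi p))
          (eq_sym (Cmult_RtoC_l k _))) S2 T2).
      + apply (K _ _ _ (fun p => eq_trans (f_equal co3 (Ephi p))
          (eq_sym (Cmult_RtoC_l k _))) S3 T3).
    - intros p. unfold on_sphere. rewrite Ephi, G0, Hk. lra.
    - intros p X. now rewrite Ds, Dt, Dphi.
    - intros p. rewrite Ds, Dt. apply Gst.
    - intros p. rewrite Ds. apply Gss.
    - intros p. rewrite Dt. apply Gtt.
    - intros p. rewrite Ds, Ephi. apply Ls.
    - intros p. rewrite Dt, Ephi. apply Lt.
    - intros p. unfold lapD.
      rewrite (dirD_ext (fun q => dirD phi q e_s)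
        (fun q : R2 => scal k (cmul (Ys (fst q)) (Z (snd q)))) p e_s Ds).
      rewrite (dirD_ext (fun q => dirD phi q e_t)
        (fun q : R2 => scal k (cmul (Y (fst q)) (Zt (snd q)))) p e_t Dt).
      rewrite (dirD_separated k Ys Z p e_s _ _ (HYs (fst p)) (HZ (snd p))).
      rewrite (dirD_separated k Y Zt p e_t _ _ (HY (fst p)) (HZt (snd p))).
      rewrite Ephi.
      refine (eq_trans (f_equal2 plus (K10 _ _) (K01 _ _)) _).
      apply lap_cmul; lra. }
  split; [ | split; [ | split]].
  + exact (legendrian_conformal_S5 _ _ _ HL).
  + exact (legendrian_harmonic_S5 _ _ _ HL).
  + exact (legendrian_conformal_CP2 _ _ _ HL).
  + exact (legendrian_harmonic_CP2 _ _ _ HL).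
Qed.
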